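(* Let $(d_1,\ldots,d_n)$ be a nonempty, nondecreasing sequence of nonnegative integers. Then every digraph on $n$ vertices whose (nondecreasingly ordered) outdegree sequence is $(d_1,\ldots,d_n)$ contains $2$ vertex disjoint cycles if and only if the sequence $(d_1,\ldots,d_n)$ is large, i.e. there exist integers $1\le r\le s\le n$ such that (a) $d_r\ge r$ and $d_s\ge s+1$, and (b) if $n\ge 2s-r+2$ and $d_{2s-r+2}=s+1$, then there is an integer $j\in[2s-r+3,n]$ with $d_j\ge j$.
   Context: Digraphs are finite; they may have loops and 2-cycles (pairs of opposite arcs $x\to y$, $y\to x$) but no parallel arcs. The outdegree of a vertex $x$ is the number of vertices $y$ (possibly $y=x$) with an arc $x\to y$; in particular a loop contributes $1$ to the outdegree. A cycle means a directed cycle; a loop counts as a cycle of length $1$ and a 2-cycle as a cycle of length $2$. The outdegree sequence of a digraph is the list of outdegrees of its vertices arranged in nondecreasing order. (If no digraph has the given outdegree sequence, the statement ''every digraph ... contains 2 vertex disjoint cycles'' holds vacuously.) *)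

(* Defs.v *)
From mathcomp Require Import all_boot.

Set Implicit Arguments.
Unset Strict Implicit.
Unset Printing Implicit Defensive.

(* A finite digraph with vertex type V is an arbitrary relation e : rel V:
   loops and 2-cycles are allowed, parallel arcs cannot occur. *)

Definition outdeg (V : finType) (e : rel V) (x : V) : nat := #|[set y | e x y]|.

Definition outdeg_seq (V : finType) (e : rel V) : seq nat :=
  sort leq [seq outdeg e x | x <- enum V].

(* The vertices in cyclic order; MathComp's ucycle also accepts [::].  A loop
   at x is [:: x], and a 2-cycle is [:: x; y] with x != y. *)
Definition is_dicycle (V : finType) (e : rel V) (c : seq V) : Prop :=
  c <> [::] /\ ucycle e c.

Definition has_two_disjoint_cycles (V : finType) (e : rel V) : Prop :=
  exists c1 c2 : seq V,
    [/\ is_dicycle e c1, is_dicycle e c2 & [disjoint c1 & c2]].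

(* The entry d_i of the sequence (d_1, ..., d_n), numbered from 1; only
   meaningful for 1 <= i <= size d. *)
Definition entry (d : seq nat) (i : nat) : nat := nth 0 d i.-1.

(* The subtraction is not truncated, since r <= s. *)
Definition large (d : seq nat) : Prop :=
  exists r s : nat,
    [/\ 1 <= r, r <= s & s <= size d] /\
    (r <= entry d r /\ s + 1 <= entry d s) /\
    (2 * s - r + 2 <= size d -> entry d (2 * s - r + 2) = s + 1 ->
       exists j : nat,
         2 * s - r + 3 <= j /\ j <= size d /\ j <= entry d j).

(* Main.v *)
Require Import Defs.
From mathcomp Require Import all_boot.
From mathcomp Require Import zify.

(* A counterexample to "large implies two disjoint cycles" is taken minimal for
   the number of vertices plus arcs.  Deleting a vertex of least outdegree shifts
   r, s and j down by one, so r = 1.  Contracting an arc p -> q (deleting p and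
   redirecting its in-arcs to q) creates no new disjoint cycles and lowers only
   the outdegrees of common in-neighbours of p and q; by minimality every arc
   p -> u has a common in-neighbour, so the in-neighbourhood of each vertex u
   contains a cycle and its complement is acyclic.  If some d_j >= j, then the
   vertices of outdegree < j and those of outdegree >= j both contain a cycle.
   Otherwise, s being minimal, there are s - 1 vertices of outdegree 1, s + 1 of
   outdegree s + 1, and the others have outdegree s + 2.  For s >= 2 the vertices
   of outdegree 1 form an in-forest with at most two roots, which together with
   its roots is dominated by all the vertices of outdegree s + 1; so the indegrees
   are large on this forest, and only out-neighbours of its roots can have
   indegree below s + 2: summing the indegrees gives a contradiction.  For s = 1
   some vertex has indegree 2, which leaves at most 5 vertices.

   Conversely, if d_i <= i for all i, an acyclic digraph plus one vertex has
   outdegree sequence d; in the other non-large cases a wheel with a directed rim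
   and a hub joined to it in both directions can be completed by vertices lying
   on no cycle or having their cycles through the hub. *)

Set Implicit Arguments.
Unset Strict Implicit.
Unset Printing Implicit Defensive.

(** * Cyclic vertex sets, contraction and deletion *)

Section Cyclic.
Context {V : finType}.
Implicit Types (e : rel V) (W A B X : {set V}).

(* A set in which every vertex has an out-neighbour contains a cycle, and the
   vertices of a cycle form such a set. *)
Definition cyc e B : bool :=
  (B != set0) && [forall x in B, [exists y in B, e x y]].

Definition two_cyc e W : Prop :=
  exists B1 B2, [/\ B1 \subset W, B2 \subset W, cyc e B1, cyc e B2 & [disjoint B1 & B2]].

Definition outN e W x : {set V} := [set y in W | e x y].
Definition inN e W x : {set V} := [set y in W | e y x].
Definition deg e W x : nat := #|outN e W x|.
Definition cnt e W k : nat := #|[set x in W | deg e W x < k]|.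
Definition mu e W : nat := #|W| + \sum_(x in W) deg e W x.

Lemma cycP e B :
  reflect (B != set0 /\ forall x, x \in B -> exists2 y, y \in B & e x y) (cyc e B).
Proof.
apply: (iffP andP) => [[B0 /forall_inP h]|[B0 h]]; split=> //.
  by move=> x /h /exists_inP [y ? ?]; exists y.
by apply/forall_inP => x /h [y yB exy]; apply/exists_inP; exists y.
Qed.

Lemma acyc_sink e X : X != set0 -> ~~ cyc e X ->
  exists2 x, x \in X & forall y, y \in X -> ~~ e x y.
Proof.
move=> X0; rewrite /cyc X0 /= => /forall_inPn [x xX /exists_inPn h].
by exists x.
Qed.

Lemma acyc_source e X : X != set0 -> (forall B, B \subset X -> ~~ cyc e B) ->
  exists2 x, x \in X & forall y, y \in X -> ~~ e y x.
Proof.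
have [k] := ubnP #|X|; elim: k X => // k IH X; rewrite ltnS => Xk X0 Xa.
have [x xX xs] := acyc_sink X0 (Xa X (subxx _)).
have [X1|X1] := eqVneq (X :\ x) set0.
  exists x => // y yX; suff -> : y = x by apply: xs.
  by apply/eqP/negPn/negP => yx; have := in_set0 y; rewrite -X1 !inE yx yX.
have [|B sB|y yX ys] := IH (X :\ x) _ X1.
- by apply: leq_trans Xk; rewrite [X in _ < X](cardsD1 x) xX.
- by apply: Xa; apply: subset_trans sB (subD1set _ _).
case/setD1P: yX => yx yX; exists y => // z zX.
have [->|zx] := eqVneq z x; first exact: xs.
by apply: ys; rewrite !inE zx zX.
Qed.

Lemma indeg_cyc e X : X != set0 ->
  (forall x, x \in X -> exists2 y, y \in X & e y x) -> exists2 B : {set V}, B \subset X & cyc e B.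
Proof.
move=> X0 h; have [/exists_inP [B]|/exists_inPn nB] :=
  boolP [exists B : {set V} in powerset X, cyc e B]; first by rewrite inE; exists B.
have [B sB|x xX xs] := acyc_source X0 (e := e); first by apply: nB; rewrite inE.
by have [y yX eyx] := h x xX; move: (xs y yX); rewrite eyx.
Qed.

Lemma deg_le e W x : deg e W x <= #|W|.
Proof. by apply: subset_leq_card; apply/subsetP => y; rewrite inE => /andP[]. Qed.

Lemma deg_lt e W x : x \in W -> ~~ e x x -> deg e W x < #|W|.
Proof.
move=> xW exx; rewrite (cardsD1 x W) xW add1n ltnS; apply: subset_leq_card.
apply/subsetP => y; rewrite !inE => /andP[-> exy]; rewrite andbT.
by apply: contraNneq exx => yx; rewrite yx in exy.
Qed.

Lemma deg_out e W X x : #|X| < deg e W x -> exists2 y, y \in W :\: X & e x y.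
Proof.
move=> h; have [/exists_inP //|/exists_inPn n] := boolP [exists y in W :\: X, e x y].
have: outN e W x \subset X.
  apply/subsetP => y; rewrite inE => /andP[yW exy]; apply/negPn/negP => yX.
  by have := n y; rewrite inE yX yW exy => /(_ isT).
by move=> /subset_leq_card; rewrite leqNgt h.
Qed.

Lemma sum_indeg e W : \sum_(x in W) #|inN e W x| = \sum_(x in W) deg e W x.
Proof.
transitivity (\sum_(x in W) \sum_(y in W | e y x) 1).
  by apply: eq_bigr => x _; rewrite sum1_card; apply: eq_card => y; rewrite !inE.
rewrite (exchange_big_dep (mem W)) /=; last by move=> ? ? _ /andP[].
apply: eq_bigr => x xW; rewrite /deg /outN sum1_card.
by apply: eq_card => y; rewrite !inE xW.
Qed.

Lemma two_cyc_sub e W W' : W' \subset W -> two_cyc e W' -> two_cyc e W.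
Proof.
move=> s [B1 [B2 [s1 s2 c1 c2 d]]]; exists B1, B2; split=> //;
exact: subset_trans s.
Qed.

Lemma cyc_sub e e' B : subrel e' e -> cyc e' B -> cyc e B.
Proof.
move=> s /cycP [B0 h]; apply/cycP; split=> // x /h [y yB /s]; by exists y.
Qed.

Lemma two_cyc_subrel e e' W : subrel e' e -> two_cyc e' W -> two_cyc e W.
Proof.
by move=> s [B1 [B2 [s1 s2 c1 c2 d]]]; exists B1, B2; split=> //; apply: cyc_sub s _.
Qed.

Definition contract e p q : rel V := [rel x y | e x y || (y == q) && e x p].

Lemma contract_cyc e p q B : p \notin B -> e p q -> cyc (contract e p q) B ->
  cyc e (if q \in B then p |: B else B).
Proof.
move=> pB epq /cycP [/set0Pn [b bB] h]; case: ifPn => qB; apply/cycP; split.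
- by apply/set0Pn; exists p; rewrite setU11.
- move=> x /setU1P [->|/h [y yB /orP[exy|/andP[_ exp]]]].
  + by exists q => //; rewrite setU1r.
  + by exists y => //; rewrite setU1r.
  + by exists p => //; rewrite setU11.
- by apply/set0Pn; exists b.
- move=> x /h [y yB /orP[exy|/andP[/eqP yq _]]]; first by exists y.
  by move: qB; rewrite -yq yB.
Qed.

Lemma contract_two_cyc e W p q : p \in W -> e p q ->
  two_cyc (contract e p q) (W :\ p) -> two_cyc e W.
Proof.
move=> pW epq [B1 [B2 [/subsetD1P [s1 p1] /subsetD1P [s2 p2] c1 c2 d]]].
exists (if q \in B1 then p |: B1 else B1), (if q \in B2 then p |: B2 else B2).
split; try exact: contract_cyc.
- by case: ifP => // _; rewrite subUset sub1set pW.
- by case: ifP => // _; rewrite subUset sub1set pW.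
- case: ifP => q1; case: ifP => q2 //.
  + by move: d; rewrite disjoint_subset => /subsetP /(_ q q1); rewrite inE q2.
  + by rewrite -setI_eq0 setIUl setU_eq0 !setI_eq0 disjoints1 p2 d.
  + by rewrite disjoint_sym -setI_eq0 setIUl setU_eq0 !setI_eq0 disjoints1 p1 disjoint_sym d.
Qed.

Lemma deg_del e W p x : deg e W x <= deg e (W :\ p) x + e x p.
Proof.
rewrite /deg /outN; case exp: (e x p); last first.
  rewrite addn0; apply: subset_leq_card; apply/subsetP => y; rewrite !inE.
  by case/andP=> -> exy; rewrite exy !andbT; apply: contraTneq exy => ->; rewrite exp.
rewrite (cardsD1 p) addnC leq_add ?leq_b1 //; apply: subset_leq_card.
by apply/subsetP => y; rewrite !inE => /and3P[-> -> ->].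
Qed.

Lemma deg_contract e W p q x : q \in W -> p != q ->
  deg e W x <= deg (contract e p q) (W :\ p) x + (e x p && e x q).
Proof.
move=> qW pq; have [exp|exp] := boolP (e x p); last first.
  rewrite addn0; apply: subset_leq_card; apply/subsetP => y; rewrite !inE /contract /=.
  case/andP=> -> exy; rewrite exy !andbT; apply: contraTneq exy => ->; exact: exp.
have [exq|exq] := boolP (e x q).
  rewrite /deg /outN (cardsD1 p) addnC leq_add ?leq_b1 //; apply: subset_leq_card.
  by apply/subsetP => y; rewrite !inE /contract /= => /and3P[-> -> ->].
rewrite addn0 /deg [X in X <= _](cardsD1 p) [X in _ <= X](cardsD1 q) leq_add //.
  by rewrite [X in _ <= nat_of_bool X]inE !inE /contract /= eq_sym pq qW /= eqxx exp orbT leq_b1.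
apply: subset_leq_card; apply/subsetP => y; rewrite !inE /contract /= => /and3P[-> -> exy].
by rewrite exy /= !andbT; apply: contraNneq exq => <-.
Qed.

Lemma deg_contract_ge e W p q x : q \in W -> p \in W ->
  deg (contract e p q) (W :\ p) x <= deg e W x.
Proof.
move=> qW pW; have [exp|exp] := boolP (e x p); last first.
  apply: subset_leq_card; apply/subsetP => y; rewrite !inE /contract /= (negbTE exp) andbF orbF.
  by case/andP => /andP[_ -> ->].
rewrite /deg (cardsD1 q) [X in _ <= X](cardsD1 p) leq_add //.
  by rewrite (_ : p \in outN e W x) ?leq_b1 // inE pW.
apply: subset_leq_card; apply/subsetP => y; rewrite !inE /contract /=.
by case: (y == q) => //=; rewrite orbF andbA.
Qed.

Definition delarc e p q : rel V := [rel x y | e x y && ~~ ((x == p) && (y == q))].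

Lemma deg_delarc e W p q x :
  deg e W x <= deg (delarc e p q) W x + (x == p).
Proof.
rewrite /deg /outN; have [->|xp] := eqVneq x p.
  rewrite (cardsD1 q) addnC leq_add ?leq_b1 //; apply: subset_leq_card.
  by apply/subsetP => y; rewrite !inE /delarc /= eqxx => /and3P[-> -> ->].
rewrite addn0; apply: subset_leq_card; apply/subsetP => y; rewrite !inE /delarc /=.
by rewrite (negbTE xp) /= andbT.
Qed.

Lemma deg_delarc_ge e W p q x : deg (delarc e p q) W x <= deg e W x.
Proof.
by apply: subset_leq_card; apply/subsetP => y; rewrite !inE /delarc /= => /and3P[-> ->].
Qed.

Lemma deg_sub e W W' x : W' \subset W -> deg e W' x <= deg e W x.
Proof.
move/subsetP => s; apply: subset_leq_card; apply/subsetP => y; rewrite !inE /delarc /=.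
by case/andP => /s -> ->.
Qed.

Lemma mu_del e e' W p : p \in W -> (forall x, deg e' (W :\ p) x <= deg e W x) ->
  mu e' (W :\ p) < mu e W.
Proof.
move=> pW h; rewrite /mu (cardsD1 p W) pW add1n addSn ltnS leq_add2l.
rewrite (big_setD1 p pW) /=; apply: leq_trans (leq_addl _ _).
by apply: leq_sum => x _.
Qed.

Lemma mu_delarc e W p q : p \in W -> q \in W -> e p q ->
  mu (delarc e p q) W < mu e W.
Proof.
move=> pW qW epq; rewrite /mu ltn_add2l (big_setD1 p pW) (big_setD1 p pW) /=.
rewrite -addSn leq_add ?leq_sum // => [|x _]; last exact: deg_delarc_ge.
apply: proper_card; apply/properP; split.
  by apply/subsetP => y; rewrite !inE /delarc /= => /and3P[-> ->].
by exists q; rewrite !inE /delarc /= ?qW ?epq // !eqxx.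
Qed.

End Cyclic.

(** * Minimal counterexamples *)

Section MinimalCounterexample.
Context {V : finType}.
Implicit Types (e : rel V) (W A B X : {set V}).

(* The condition "large" on the outdegrees in W, expressed by counting vertices of
   small outdegree instead of sorting. *)
Definition large_on e W : Prop :=
  exists r s, [/\ 0 < r, r <= s, s <= #|W| & [/\ cnt e W r < r, cnt e W s.+1 < s &
    cnt e W s.+2 < 2 * s - r + 2 \/
    exists j, [/\ 2 * s - r + 3 <= j, j <= #|W| & cnt e W j < j]]].

Definition mincex e W : Prop :=
  ~ two_cyc e W /\
  forall e' W', mu e' W' < mu e W -> large_on e' W' -> two_cyc e' W'.

Lemma mincex_del e W p : mincex e W -> p \in W -> ~ large_on e (W :\ p).
Proof.
move=> [nT IH] pW g; apply: nT; apply: two_cyc_sub (subD1set W p) (IH _ _ _ g).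
by apply: mu_del => // x; apply: deg_sub; apply: subD1set.
Qed.

Lemma mincex_contract e W p q : mincex e W -> p \in W -> q \in W -> e p q ->
  ~ large_on (contract e p q) (W :\ p).
Proof.
move=> [nT IH] pW qW epq g; apply: nT; apply: (contract_two_cyc pW epq).
by apply: IH g; apply: mu_del => // x; apply: deg_contract_ge.
Qed.

Lemma mincex_delarc e W p q : mincex e W -> p \in W -> q \in W -> e p q ->
  ~ large_on (delarc e p q) W.
Proof.
move=> [nT IH] pW qW epq g; apply: nT; apply: (@two_cyc_subrel _ _ (delarc e p q)).
  by move=> x y /andP[].
by apply: IH g; apply: mu_delarc.
Qed.

Lemma acyc_cnt e W A k : A \subset W -> (forall B, B \subset A -> ~~ cyc e B) ->
  k <= #|A| -> k <= cnt e W (k + #|W :\: A|).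
Proof.
move=> AW Aa kA; rewrite leqNgt; apply/negP => h.
pose X := [set v in A | k + #|W :\: A| <= deg e W v].
have XA : X \subset A by apply/subsetP => v; rewrite inE => /andP[].
have hX : #|A :\: X| <= cnt e W (k + #|W :\: A|).
  apply: subset_leq_card; apply/subsetP => v; rewrite !inE => /andP[+ vA].
  by rewrite vA (subsetP AW) // -ltnNge.
have cX := cardsID X A; rewrite (setIidPr XA) in cX.
have X0 : X != set0 by rewrite -card_gt0; lia.
have [v vX vs] := acyc_sink X0 (Aa _ XA).
have cW := cardsID A W; rewrite (setIidPr AW) in cW.
have cWX := cardsID X W; rewrite (setIidPr (subset_trans XA AW)) in cWX.
have [|y yX evy] := @deg_out _ e W (W :\: X) v.
  by move: vX; rewrite inE => /andP[_]; lia.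
have := vs y; rewrite evy; move: yX; rewrite !inE => /andP[+ yW].
by rewrite yW andbT negbK => -> /(_ isT).
Qed.

Lemma disjoint_cyc e W B1 B2 : ~ two_cyc e W -> B1 \subset W -> cyc e B1 ->
  B2 \subset W :\: B1 -> ~~ cyc e B2.
Proof.
move=> nT s1 c1; rewrite subsetD => /andP[s2 d]; apply/negP => c2; apply: nT.
by exists B1, B2; split=> //; rewrite disjoint_sym.
Qed.

Lemma no_loop e W x : ~ two_cyc e W -> large_on e W -> x \in W -> ~~ e x x.
Proof.
move=> nT [r [s [r0 rs sW [_ cs _]]]] xW; apply/negP => exx.
have cx : cyc e [set x].
  apply/cycP; split; first by apply/set0Pn; exists x; rewrite set11.
  by move=> y /set1P ->; exists x => //; rewrite set11.
have sx : [set x] \subset W by rewrite sub1set.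
have ax := disjoint_cyc nT sx cx.
have cW := cardsD1 x W; rewrite xW in cW.
have := @acyc_cnt e W (W :\ x) s (subD1set _ _) ax.
have -> : #|W :\: (W :\ x)| = 1.
  by rewrite setDDr setDv set0U (setIidPr sx) cards1.
have [sW'|sW'] := leqP s #|W :\ x|; first by rewrite addn1 => /(_ isT); lia.
suff: #|W| <= cnt e W s.+1 by lia.
apply: subset_leq_card; apply/subsetP => y yW; rewrite inE yW /= ltnS.
by apply: leq_trans (deg_le e W y) _; lia.
Qed.

Lemma cnt_mono e e' W W' k k' :
  (forall x, x \in W' -> deg e' W' x < k -> x \in W /\ deg e W x < k') ->
  cnt e' W' k <= cnt e W k'.
Proof.
move=> h; apply: subset_leq_card; apply/subsetP => x; rewrite !inE.
by case/andP=> xW /h [] // -> ->.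
Qed.

Lemma cnt_monoD1 e e' W p k k' : p \in W -> deg e W p < k' ->
  (forall x, x \in W :\ p -> deg e' (W :\ p) x < k -> deg e W x < k') ->
  cnt e' (W :\ p) k < cnt e W k'.
Proof.
move=> pW dp h; rewrite /cnt [X in _ < X](cardsD1 p) inE pW dp /= add1n ltnS.
apply: subset_leq_card; apply/subsetP => x xs; move: (xs); rewrite !inE.
by case/andP => /andP[xp xW] dx; rewrite xp xW (h x) // !inE xp.
Qed.

Lemma cnt_del_min e W p k : p \in W -> (forall x, x \in W -> deg e W p <= deg e W x) ->
  cnt e (W :\ p) k <= (cnt e W k.+1).-1.
Proof.
move=> pW pmin; have hd x : x \in W :\ p -> deg e (W :\ p) x < k -> deg e W x < k.+1.
  by move=> _; have := deg_del e W p x; lia.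
have [dp|dp] := leqP (deg e W p) k; first by have := @cnt_monoD1 e e W p k k.+1 pW dp hd; lia.
suff -> : cnt e (W :\ p) k = 0 by [].
apply/eqP; rewrite cards_eq0 -subset0; apply/subsetP => x; rewrite !inE.
case/andP=> /andP[xp xW] /hd; rewrite !inE xp xW => /(_ isT).
by have := pmin x xW; lia.
Qed.

Lemma mincex_mindeg e W : mincex e W -> large_on e W ->
  exists s, [/\ 0 < s, s <= #|W|, forall x, x \in W -> 0 < deg e W x, cnt e W s.+1 < s &
    cnt e W s.+2 <= 2 * s \/ exists j, [/\ 2 * s + 2 <= j, j <= #|W| & cnt e W j < j]].
Proof.
move=> mW [r [s [r0 rs sW [cr cs cj]]]].
have [r1|r1] := leqP r 1.
  have {r1 r0} re : r = 1 by lia.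
  exists s; split=> //; first by lia.
    move=> x xW; rewrite lt0n; apply/negP => /eqP dx.
    move: cr; rewrite re ltnS leqn0 cards_eq0 => /eqP/setP/(_ x).
    by rewrite !inE xW dx.
  by case: cj => [|[j [? ? ?]]]; [left; lia|right; exists j; split=> //; lia].
have /card_gt0P [p0 p0W] : 0 < #|W| by lia.
have [p pW pmin] : exists2 p, p \in W & forall x, x \in W -> deg e W p <= deg e W x.
  by have [p pW pmin] := @arg_minnP _ p0 (mem W) (deg e W) p0W; exists p.
have cD := cnt_del_min _ pW pmin.
have cW := cardsD1 p W; rewrite pW in cW.
case: (mincex_del mW pW); exists r.-1, s.-1; split; [lia..|].
have /(_ r.-1) := cD; have /(_ s) := cD; have /(_ s.+1) := cD.
have -> : s.-1.+1 = s by lia.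
have -> : r.-1.+1 = r by lia.
move=> c1 c2 c3; split; [lia..|].
case: cj => [?|[j [? ? ?]]]; [left; lia|right].
exists j.-1; have := cD j.-1.
have -> : j.-1.+1 = j by lia.
by move=> ?; split; lia.
Qed.

Definition largeA e W s : Prop :=
  [/\ 0 < s, s <= #|W|, forall x, x \in W -> 0 < deg e W x,
      cnt e W s.+1 < s & cnt e W s.+2 <= 2 * s].

Definition largeB e W s j : Prop :=
  [/\ 0 < s, forall x, x \in W -> 0 < deg e W x, cnt e W s.+1 < s &
      [/\ 2 * s + 2 <= j, j <= #|W| & cnt e W j < j]].

Lemma cnt1_eq0 e W : (forall x, x \in W -> 0 < deg e W x) -> cnt e W 1 = 0.
Proof.
move=> h; apply/eqP; rewrite cards_eq0 -subset0; apply/subsetP => x; rewrite !inE.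
by case/andP => /h; lia.
Qed.

Lemma largeA_large_on e W s : largeA e W s -> large_on e W.
Proof.
move=> [s0 sW d1 cs cs2]; exists 1, s; split=> //; split=> //; last by left; lia.
by rewrite cnt1_eq0.
Qed.

Lemma largeB_large_on e W s j : largeB e W s j -> large_on e W.
Proof.
move=> [s0 d1 cs [js jW cj]]; exists 1, s; split=> //; first by lia.
split=> //; first by rewrite cnt1_eq0.
by right; exists j; split=> //; lia.
Qed.

Lemma mincex_not_largeB e W s j : mincex e W -> (forall s, ~ largeA e W s) -> ~ largeB e W s j.
Proof.
move=> mW nA lB; have nT := mW.1; have lp x := no_loop nT (largeB_large_on lB) (x := x).
case: (lB) => s0 d1 cs [js jW cj].
have [/eqP|] := posnP (cnt e W s.+1); last first.
  move=> /card_gt0P [x]; rewrite inE => /andP[xW dx].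
  have /card_gt0P[q] := d1 x xW; rewrite inE => /andP[qW exq].
  have xq : x != q by apply: contraTneq exq => <-; apply: lp.
  have dC y := deg_contract e y qW xq.
  have cW := cardsD1 x W; rewrite xW in cW.
  case: (mincex_contract mW xW qW exq); apply: (@largeB_large_on _ _ s.-1 j.-1).
  have c1 : cnt (contract e x q) (W :\ x) s < cnt e W s.+1.
    by apply: cnt_monoD1 => // y _; have := dC y; lia.
  have c2 : cnt (contract e x q) (W :\ x) j.-1 < cnt e W j.
    by apply: cnt_monoD1 => //; [lia|move=> y _; have := dC y; lia].
  split; [lia| |have -> : s.-1.+1 = s; lia|by split; lia].
  move=> y /setD1P [yx yW]; have := dC y; have := d1 y yW.
  have [/andP[eyx eyq]|_] := boolP (e y x && e y q); last by lia.
  suff: 1 < deg e W y by lia.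
  rewrite /deg (cardsD1 x) (cardsD1 q) !inE xW eyx qW eyq eq_sym xq /=; lia.
rewrite cards_eq0 => /eqP S0.
have ds x : x \in W -> s < deg e W x.
  by move=> xW; rewrite ltnNge; apply/negP => h; have := in_set0 x; rewrite -S0 !inE xW ltnS h.
pose M := [set x in W | deg e W x < j].
have MW : M \subset W by apply/subsetP => x; rewrite inE => /andP[].
have [M0|M0] := eqVneq M set0.
  apply: (nA s); split=> //; first by lia.
  suff -> : cnt e W s.+2 = 0 by [].
  apply/eqP; rewrite cards_eq0 -subset0 -M0; apply/subsetP => x; rewrite !inE.
  by case/andP => ->; lia.
have common m q : m \in M -> q \in W -> e m q -> exists2 m', m' \in M & e m' m && e m' q.
  move=> mM qW emq; have [/exists_inP //|/exists_inPn nM] :=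
    boolP [exists m' in M, e m' m && e m' q].
  have [mW' dm] : m \in W /\ deg e W m < j by apply/andP; move: mM; rewrite inE.
  have mq : m != q by apply: contraTneq emq => <-; apply: lp.
  have dC y := deg_contract e y qW mq.
  have cW := cardsD1 m W; rewrite mW' in cW.
  have dM y : y \in M -> deg e W y <= deg (contract e m q) (W :\ m) y.
    by move=> yM; have := dC y; rewrite (negbTE (nM y yM)) addn0.
  have dL y : y \in W -> y \notin M -> j <= deg e W y by move=> yW; rewrite inE yW -leqNgt.
  have d2 y : y \in W :\ m -> s < deg (contract e m q) (W :\ m) y.
    move=> /setD1P [_ yW]; have [yM|yM] := boolP (y \in M).
      by move: (dM y yM) (ds y yW); clear; lia.
    by move: (dL y yW yM) (dC y) js; clear; lia.
  have cM k : k < j -> cnt (contract e m q) (W :\ m) k < cnt e W j.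
    by move=> kj; apply: cnt_monoD1 => // y _; move: (dC y) kj; clear; lia.
  have c0 : cnt (contract e m q) (W :\ m) s.+1 = 0.
    apply/eqP; rewrite cards_eq0 -subset0; apply/subsetP => x; rewrite !inE.
    by move=> h; have := d2 x; rewrite !inE; lia.
  case: (mincex_contract mW mW' qW emq).
  have [j4|j4] := leqP j (2 * s + 2).
    apply: (@largeA_large_on _ _ s); split=> //; [lia| |lia|].
      by move=> x xs; have := d2 x xs; lia.
    by have := cM s.+2; lia.
  apply: (@largeB_large_on _ _ s j.-1); split=> //; [|lia|].
    by move=> x xs; have := d2 x xs; lia.
  by split; [lia|lia|have := cM j.-1; lia].
have [x xM|B BM cB] := @indeg_cyc _ e M M0.
  have := ds x (subsetP MW _ xM) => dx.
  have /card_gt0P [q] : 0 < deg e W x by lia.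
  rewrite inE => /andP[qW exq]; have [m mM /andP[emx _]] := common x q xM qW exq.
  by exists m.
have dWM : W :\: M != set0.
  by rewrite -card_gt0 cardsD (setIidPr MW) subn_gt0; apply: leq_trans jW.
suff cL : cyc e (W :\: M).
  have := disjoint_cyc nT (subset_trans BM MW) cB (setDS W BM).
  by rewrite cL.
apply/cycP; split=> // x /setDP [xW xM]; apply: deg_out.
by move: xM; rewrite inE xW -leqNgt; apply: leq_trans.
Qed.

End MinimalCounterexample.

Section CriticalRecord.
Context {V : finType}.
Implicit Types (e : rel V) (W A B X : {set V}).

(* What remains of a minimal counterexample with r = 1 and without the alternative
   d_j >= j, when s is also chosen minimal. *)
Record critical e W s : Prop := Critical {
  crit_two_cyc : ~ two_cyc e W;
  crit_loop : forall x, x \in W -> ~~ e x x;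
  crit_gt0 : 0 < s;
  crit_cntS : cnt e W s.+1 = s.-1;
  crit_cntM : cnt e W s.+2 = 2 * s;
  crit_deg_ge1 : forall x, x \in W -> 0 < deg e W x;
  crit_degS : forall x, x \in W -> deg e W x <= s -> deg e W x = 1;
  crit_degL : forall x, x \in W -> deg e W x <= s.+2;
  crit_common : forall p q, p \in W -> q \in W -> e p q ->
    exists2 z, z \in W & e z p && e z q;
  crit_in : forall u, u \in W -> exists2 z, z \in W & e z u;
  crit_dominate : forall x q m, x \in W -> q \in W -> m \in W -> e x q ->
    deg e W x <= s -> deg e W m = s.+1 -> e m x && e m q;
  crit_commonM : forall m q, m \in W -> q \in W -> e m q -> deg e W m = s.+1 ->
    (exists z, [/\ z \in W, deg e W z = s.+1, e z m & e z q]) \/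
    (exists l1 l2, [/\ l1 != l2, [/\ l1 \in W, e l1 m, e l1 q & deg e W l1 = s.+2] &
                       [/\ l2 \in W, e l2 m, e l2 q & deg e W l2 = s.+2]])
}.

Lemma cnt_monoD e e' W W' X k k' : X \subset [set x in W | deg e W x < k'] ->
  (forall x, x \in W' -> deg e' W' x < k -> [/\ x \in W, x \notin X & deg e W x < k']) ->
  cnt e' W' k + #|X| <= cnt e W k'.
Proof.
move=> sX h; rewrite /cnt -(cardsID X [set x in W | deg e W x < k']) addnC.
rewrite (setIidPr sX) leq_add2l; apply: subset_leq_card; apply/subsetP => x.
by rewrite !inE => /andP[xW /h] [] // -> -> ->.
Qed.

Lemma two_out e W x p q : p \in W -> q \in W -> p != q -> e x p -> e x q ->
  1 < deg e W x.
Proof.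
by move=> pW qW pq xp xq; apply/card_gt1P; exists p, q; rewrite !inE pW qW xp xq.
Qed.

Lemma mincex_critical e W s : mincex e W -> largeA e W s ->
  exists s', critical e W s'.
Proof.
move=> mW; have nT := mW.1.
have [k] := ubnP s; elim: k s => // k IH s; rewrite ltnS => sk lA.
case: (lA) => s0 sW d1 cs cs2.
have [/eqP cS|cS] := boolP (cnt e W s.+1 == s.-1); last first.
  apply: (IH s.-1); first by lia.
  have cm : cnt e W s <= cnt e W s.+1.
    by apply: cnt_mono => x xW dx; split=> //; apply: ltnW.
  by split; [lia|lia|by []|have -> : s.-1.+1 = s; lia|have -> : s.-1.+1 = s; lia].
have lp x := no_loop nT (largeA_large_on lA) (x := x).
have neq p q : p \in W -> e p q -> p != q.
  by move=> pW epq; apply: contraTneq epq => <-; apply: lp.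
have [v vW dv] : exists2 v, v \in W & s < deg e W v.
  have [/exists_inP//|/exists_inPn h] := boolP [exists v in W, s < deg e W v].
  suff: #|W| <= cnt e W s.+1 by lia.
  apply: subset_leq_card; apply/subsetP => x xW; rewrite inE xW ltnS leqNgt.
  exact: h.
have W2 : s.+1 < #|W| by have := deg_lt vW (lp v vW); lia.
have degS x : x \in W -> deg e W x <= s -> deg e W x = 1.
  move=> xW dx; apply/eqP; rewrite eqn_leq d1 // andbT leqNgt; apply/negP => dx1.
  have /card_gt0P[q] := d1 x xW; rewrite inE => /andP[qW exq].
  apply: (mincex_delarc mW xW qW exq); apply: (@largeA_large_on _ _ _ s).
  have dD y := deg_delarc e W x q y.
  split=> //.
  - by move=> y yW; have := dD y; have := d1 y yW; case: eqVneq => [->|_]; lia.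
  - apply: leq_ltn_trans cs; apply: cnt_mono => y yW; have := dD y.
    by case: eqVneq => [->|_]; split=> //; lia.
  - apply: leq_trans cs2; apply: cnt_mono => y yW; have := dD y.
    by case: eqVneq => [->|_]; split=> //; lia.
have degL x : x \in W -> deg e W x <= s.+2.
  move=> xW; rewrite leqNgt; apply/negP => dx.
  have /card_gt0P[q] := d1 x xW; rewrite inE => /andP[qW exq].
  apply: (mincex_delarc mW xW qW exq); apply: (@largeA_large_on _ _ _ s).
  have dD y := deg_delarc e W x q y.
  split=> //.
  - by move=> y yW; have := dD y; have := d1 y yW; case: eqVneq => [->|_]; lia.
  - apply: leq_ltn_trans cs; apply: cnt_mono => y yW; have := dD y.
    by case: eqVneq => [->|_]; split=> //; lia.
  - apply: leq_trans cs2; apply: cnt_mono => y yW; have := dD y.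
    by case: eqVneq => [->|_]; split=> //; lia.
have pW1 p : p \in W -> s <= #|W :\ p|.
  by move=> pW; have := cardsD1 p W; rewrite pW; lia.
have F3 x q : x \in W -> q \in W -> e x q -> deg e W x <= s ->
    cnt e W s.+2 = 2 * s /\
    forall m, m \in W -> deg e W m = s.+1 -> e m x && e m q.
  move=> xW qW exq dx; have xq := neq _ _ xW exq.
  have dC y := deg_contract e y qW xq.
  have nl := mincex_contract mW xW qW exq.
  have c1 : cnt (contract e x q) (W :\ x) s < cnt e W s.+1.
    by apply: cnt_monoD1 => // y _; have := dC y; lia.
  have c2 : 2 * s < cnt (contract e x q) (W :\ x) s.+1 + 2.
    rewrite ltnNge; apply/negP => c2; apply: nl; apply: (@largeA_large_on _ _ _ s.-1).
    have W1 := pW1 x xW.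
    split; [lia|lia| |have -> : s.-1.+1 = s; lia|have -> : s.-1.+1 = s; lia].
    move=> y /setD1P [yx yW]; have := dC y; have := d1 y yW.
    have [/andP[eyx eyq]|_] := boolP (e y x && e y q); last by lia.
    by move: (two_out xW qW xq eyx eyq); clear; lia.
  split.
    have : cnt (contract e x q) (W :\ x) s.+1 < cnt e W s.+2; last by lia.
    by apply: cnt_monoD1 => // [|y _]; [lia|have := dC y; lia].
  move=> m mW' dm; have [//|nm] := boolP (e m x && e m q).
  suff : cnt (contract e x q) (W :\ x) s.+1 + #|[set x; m]| <= cnt e W s.+2.
    rewrite cards2; have -> : x != m; last by lia.
    by apply/eqP => xm; rewrite -xm in dm; lia.
  apply: cnt_monoD.
    by rewrite subUset !sub1set !inE xW mW' dm ltnSn; lia.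
  move=> y /setD1P [yx yW] dy; rewrite yW !inE (negbTE yx) /=.
  have [ym|ym] := eqVneq y m; last by split=> //; move: (dC y) dy; clear; lia.
  by move: (dC m) dy; rewrite (negbTE nm) ym dm; clear; lia.
have cM : cnt e W s.+2 = 2 * s.
  have [s1|s1] := leqP s 1; last first.
    have /card_gt0P[x] : 0 < cnt e W s.+1 by lia.
    rewrite inE ltnS => /andP[xW dx].
    have /card_gt0P[q] := d1 x xW; rewrite inE => /andP[qW exq].
    by have [] := F3 x q xW qW exq dx.
  apply/eqP; rewrite eqn_leq cs2 leqNgt; apply/negP => c2.
  have [x xW dx] : exists2 x, x \in W & s.+1 < deg e W x.
    have [/exists_inP//|/exists_inPn h] := boolP [exists v in W, s.+1 < deg e W v].
    suff: #|W| <= cnt e W s.+2 by lia.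
    apply: subset_leq_card; apply/subsetP => x xW; rewrite inE xW ltnS leqNgt.
    exact: h.
  have /card_gt0P[q] := d1 x xW; rewrite inE => /andP[qW exq].
  apply: (mincex_delarc mW xW qW exq); apply: (@largeA_large_on _ _ _ s).
  have dD y := deg_delarc e W x q y.
  split=> //.
  - by move=> y yW; have := dD y; have := d1 y yW; case: eqVneq => [->|_]; lia.
  - apply: leq_ltn_trans cs; apply: cnt_mono => y yW; have := dD y.
    by case: eqVneq => [->|_]; split=> //; lia.
  - apply: leq_trans c2; rewrite /cnt -[X in _ <= X]add1n -[X in _ <= X + _](cards1 x).
    apply: leq_trans (leq_card_setU _ _).1; apply: subset_leq_card.
    apply/subsetP => y; rewrite !inE => /andP[-> dy]; have := dD y.
    by case: eqVneq => //= _; lia.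
exists s; split=> //.
- move=> p q pW qW epq; have [/exists_inP//|/exists_inPn h] :=
    boolP [exists z in W, e z p && e z q].
  have pq := neq _ _ pW epq.
  have dC y : y \in W -> deg e W y <= deg (contract e p q) (W :\ p) y.
    by move=> yW; have := deg_contract e y qW pq; rewrite (negbTE (h y yW)) addn0.
  case: (mincex_contract mW pW qW epq); apply: (@largeA_large_on _ _ _ s).
  have cm i : cnt (contract e p q) (W :\ p) i <= cnt e W i.
    by apply: cnt_mono => y /setD1P [_ yW]; have := dC y yW; split=> //; lia.
  split=> //; [exact: pW1| | |].
  + by move=> y /setD1P [_ yW]; have := dC y yW; have := d1 y yW; lia.
  + by have := cm s.+1; lia.
  + by have := cm s.+2; lia.
- move=> u uW; have [/exists_inP//|/exists_inPn h] := boolP [exists z in W, e z u].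
  have dC y : y \in W -> deg e W y <= deg e (W :\ u) y.
    by move=> yW; have := deg_del e W u y; rewrite (negbTE (h y yW)) addn0.
  case: (mincex_del mW uW); apply: (@largeA_large_on _ _ _ s).
  have cm i : cnt e (W :\ u) i <= cnt e W i.
    by apply: cnt_mono => y /setD1P [_ yW]; have := dC y yW; split=> //; lia.
  split=> //; [exact: pW1| | |].
  + by move=> y /setD1P [_ yW]; have := dC y yW; have := d1 y yW; lia.
  + by have := cm s.+1; lia.
  + by have := cm s.+2; lia.
- by move=> x q m xW qW mW' exq dx dm; have [_] := F3 x q xW qW exq dx; apply.
- move=> m q mW' qW emq dm; have mq := neq _ _ mW' emq.
  pose Z := [set y in W | e y m && e y q].
  have [/exists_inP[z]|/exists_inPn h] := boolP [exists z in Z, deg e W z == s.+1].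
    by rewrite inE => /and3P[zW zm zq] /eqP dz; left; exists z.
  have dZ z : z \in Z -> deg e W z = s.+2.
    move=> zZ; have := h z zZ; move: zZ; rewrite inE => /and3P[zW zm zq].
    have := two_out mW' qW mq zm zq; have := degL z zW.
    by have [/(degS z zW)|] := leqP (deg e W z) s; lia.
  have [/card_gt1P [l1 [l2 [l1Z l2Z l12]]]|Z1] := ltnP 1 #|Z|.
    right; exists l1, l2; split=> //; rewrite dZ //.
      by move: l1Z; rewrite inE => /and3P[].
    by move: l2Z; rewrite inE => /and3P[].
  have dC y : y \in W -> deg e W y <= deg (contract e m q) (W :\ m) y + (y \in Z).
    by move=> yW; rewrite inE yW; exact: deg_contract.
  case: (mincex_contract mW mW' qW emq); apply: (@largeA_large_on _ _ _ s).
  split=> //; [exact: pW1| | |].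
  + move=> y /setD1P [_ yW]; have := dC y yW; have := d1 y yW.
    by have [/dZ|_] := boolP (y \in Z); lia.
  + apply: leq_ltn_trans cs; apply: cnt_mono => y /setD1P [_ yW]; have := dC y yW.
    by have [/dZ|_] := boolP (y \in Z); split=> //; lia.
  + rewrite -cM [X in _ <= X](cardsD1 m) inE mW' dm ltnSn.
    apply: (@leq_trans (#|Z| + #|[set x in W | deg e W x < s.+2] :\ m|)); last first.
      by rewrite leq_add2r.
    apply: leq_trans (leq_card_setU _ _).1; apply: subset_leq_card.
    apply/subsetP => y; rewrite in_setU !in_setD1 !inE => /andP[/andP[-> yW]].
    have := dC y yW; rewrite inE yW /=.
    by case: (e y m && e y q) => //=; lia.
Qed.

End CriticalRecord.

(** * Critical digraphs with s > 1 *)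

Section Critical.
Context {V : finType}.
Implicit Types (W A B X R : {set V}).
Context (e : rel V) (W : {set V}) (s : nat) (cr : critical e W s).

Lemma crit_neq p q : p \in W -> e p q -> p != q.
Proof. by move=> pW epq; apply: contraTneq epq => <-; exact: (crit_loop cr). Qed.

Lemma inN_sub u : inN e W u \subset W.
Proof. by apply/subsetP => x; rewrite inE => /andP[]. Qed.

Lemma crit_inN_cyc u : u \in W -> exists2 B : {set V}, B \subset inN e W u & cyc e B.
Proof.
move=> uW; apply: indeg_cyc.
  by have [z zW ezu] := crit_in cr uW; apply/set0Pn; exists z; rewrite inE zW.
move=> x; rewrite inE => /andP[xW exu].
have [z zW /andP[ezx ezu]] := crit_common cr xW uW exu.
by exists z => //; rewrite inE zW.
Qed.

Lemma crit_acyc u B : u \in W -> B \subset W :\: inN e W u -> ~~ cyc e B.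
Proof.
move=> uW sB; have [A sA cA] := crit_inN_cyc uW.
apply: disjoint_cyc (crit_two_cyc cr) (subset_trans sA (inN_sub u)) cA _.
exact: subset_trans sB (setDS _ sA).
Qed.

Lemma crit_indeg u : u \in W -> 1 < #|inN e W u|.
Proof.
move=> uW; have [A sA /cycP[/set0Pn [x xA] h]] := crit_inN_cyc uW.
have [y yA exy] := h x xA; apply/card_gt1P; exists x, y; rewrite !(subsetP sA) //.
by split=> //; apply: crit_neq => //; apply: (subsetP (inN_sub u)); apply: (subsetP sA).
Qed.

Lemma cntE k : cnt e W k = \sum_(x in W) (deg e W x < k).
Proof.
rewrite /cnt -sum1_card big_mkcond [RHS]big_mkcond /=; apply: eq_bigr => x _.
by rewrite !inE; case: (x \in W) => //=; case: ltnP.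
Qed.

Lemma crit_sum : \sum_(x in W) #|inN e W x| + s * s.+1 = s.+2 * #|W|.
Proof.
have s0 := crit_gt0 cr.
rewrite sum_indeg [RHS]mulnC -sum_nat_const.
have -> : s * s.+1 = \sum_(x in W) (s * (deg e W x < s.+1) + (deg e W x < s.+2)).
  rewrite big_split /= -big_distrr /= -!cntE (crit_cntS cr) (crit_cntM cr); nia.
rewrite -big_split /=; apply: eq_bigr => x xW.
have := crit_degL cr xW; have [dx|dx] := ltnP (deg e W x) s.+1.
  by rewrite (crit_degS cr xW dx); lia.
by lia.
Qed.

Definition lowS := [set x in W | deg e W x <= s].
Definition midM := [set x in W | deg e W x == s.+1].

Lemma card_lowS : #|lowS| = s.-1.
Proof. exact: (crit_cntS cr). Qed.

Lemma card_midM : #|midM| = s.+1.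
Proof.
have s0 := crit_gt0 cr.
have : cnt e W s.+2 = #|lowS| + #|midM|.
  rewrite /cnt; have -> : [set x in W | deg e W x < s.+2] = lowS :|: midM.
    by apply/setP => x; rewrite !inE; case: (x \in W) => //=; lia.
  rewrite cardsU; have -> : lowS :&: midM = set0; last by rewrite cards0 subn0.
  by apply/setP => x; rewrite !inE; case: (x \in W) => //=; lia.
by rewrite card_lowS (crit_cntM cr); lia.
Qed.

Definition succ x := odflt x [pick q in W | e x q].

Lemma succP x : x \in W -> succ x \in W /\ e x (succ x).
Proof.
move=> xW; rewrite /succ; case: pickP => [q /andP[] //|h].
have /card_gt0P [q] := crit_deg_ge1 cr xW.
by rewrite inE => hq; have := h q; rewrite /= hq.
Qed.

Lemma succ_uniq x q : x \in lowS -> q \in W -> e x q -> q = succ x.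
Proof.
rewrite inE => /andP[xW dx] qW exq; have [fW ef] := succP xW.
apply/eqP/negPn/negP => nq; have := two_out qW fW nq exq ef.
by rewrite (crit_degS cr xW dx).
Qed.

(* An in-forest: low vertices have a single out-neighbour, and the roots are the
   vertices that are not low. *)
Definition forest := lowS :|: succ @: lowS.

Lemma lowS_sub : lowS \subset W.
Proof. by apply/subsetP => x; rewrite inE => /andP[]. Qed.

Lemma midM_sub : midM \subset W.
Proof. by apply/subsetP => x; rewrite inE => /andP[]. Qed.

Lemma forest_sub : forest \subset W.
Proof.
rewrite subUset lowS_sub; apply/subsetP => _ /imsetP [x xS ->].
by have [] := succP (subsetP lowS_sub _ xS).
Qed.

Lemma succ_forest x : x \in lowS -> succ x \in forest.
Proof. by move=> xS; rewrite inE imset_f ?orbT. Qed.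

Lemma midM_forest m t : m \in midM -> t \in forest -> e m t.
Proof.
rewrite inE => /andP[mW /eqP dm].
have h x : x \in lowS -> e m x && e m (succ x).
  move=> xS; have xW := subsetP lowS_sub _ xS; have [fW ef] := succP xW.
  by apply: (crit_dominate cr) => //; move: xS; rewrite inE => /andP[].
by case/setUP => [/h /andP[]|/imsetP [x /h /andP[_ ?] ->]].
Qed.

Lemma midM_notin_forest m : m \in midM -> m \notin forest.
Proof.
move=> mM; apply/negP => mT; have := midM_forest mM mT; apply/negP.
exact: (crit_loop cr) (subsetP midM_sub _ mM).
Qed.

Lemma midM_neq0 : exists m, m \in midM.
Proof. by apply/card_gt0P; rewrite card_midM. Qed.

Lemma card_forest : #|forest| <= s.+1.
Proof.
have [m mM] := midM_neq0.
have -> : s.+1 = deg e W m by move: mM; rewrite inE => /andP[_ /eqP].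
apply: subset_leq_card; apply/subsetP => t tT.
by rewrite inE (subsetP forest_sub) //; apply: midM_forest.
Qed.

Definition roots := forest :\: lowS.

Lemma roots_sub : roots \subset W.
Proof. exact: subset_trans (subsetDl _ _) forest_sub. Qed.

Lemma deg_high x : x \in W -> x \notin lowS -> x \notin midM -> deg e W x = s.+2.
Proof. by move=> xW; have := crit_degL cr xW; rewrite !inE xW /=; lia. Qed.

Lemma deg_roots y : y \in roots -> deg e W y = s.+2.
Proof.
move=> yY; have yW := subsetP roots_sub _ yY; case/setDP: yY => yT yS.
by apply: deg_high => //; apply: contraL yT; exact: midM_notin_forest.
Qed.

Lemma card_roots : #|roots| <= 2.
Proof.
have := card_forest; rewrite cardsD (setIidPr (subsetUl _ _)) card_lowS.
by have := crit_gt0 cr; lia.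
Qed.

Hypothesis s_gt1 : 1 < s.

Lemma lowS_neq0 : lowS != set0.
Proof. by rewrite -card_gt0 card_lowS; lia. Qed.

Lemma roots_neq0 : roots != set0.
Proof.
apply/negP => /eqP Y0.
have hS : forest \subset lowS by rewrite -setD_eq0; apply/eqP.
have cS : cyc e lowS.
  apply/cycP; split=> [|x xS]; first exact: lowS_neq0.
  exists (succ x); first exact: subsetP hS _ (succ_forest xS).
  by have [] := succP (subsetP lowS_sub _ xS).
have := disjoint_cyc (crit_two_cyc cr) lowS_sub cS (subxx _); apply/negP/negPn.
apply/cycP; split.
  have [m mM] := midM_neq0; apply/set0Pn; exists m.
  rewrite inE (subsetP midM_sub) // andbT; apply: contra (midM_notin_forest mM).
  by move=> mS; rewrite /forest in_setU mS.
move=> x /setDP[xW]; rewrite inE xW /= -ltnNge => dx.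
by apply: deg_out; rewrite card_lowS; lia.
Qed.

Lemma midM_acyc B : B \subset midM -> ~~ cyc e B.
Proof.
move=> sB; apply/negP => cB.
have := disjoint_cyc (crit_two_cyc cr) (subset_trans sB midM_sub) cB (setDS _ sB).
apply/negP/negPn/cycP; split.
  have [x xS] := set0Pn _ lowS_neq0; apply/set0Pn; exists x.
  rewrite inE (subsetP lowS_sub) // andbT; apply/negP => /midM_notin_forest.
  by rewrite /forest in_setU xS.
move=> x /setDP[xW xM]; have [xS|xS] := boolP (x \in lowS).
  have [fW ef] := succP xW; exists (succ x) => //; rewrite inE fW andbT.
  by apply/negP => /midM_notin_forest; rewrite succ_forest.
by apply: deg_out; rewrite card_midM (deg_high xW).
Qed.

Lemma indeg_forest t : t \in forest -> s.+3 <= #|inN e W t|.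
Proof.
move=> tT; have tW := subsetP forest_sub _ tT.
have M0 : midM != set0 by rewrite -card_gt0 card_midM.
have [m mM ms] := acyc_source M0 midM_acyc.
have mW := subsetP midM_sub _ mM; have emt := midM_forest mM tT.
have dm : deg e W m = s.+1 by move: mM; rewrite inE => /andP[_ /eqP].
case: (crit_commonM cr mW tW emt dm) => [[z [zW dz ezm _]]|].
  by have := ms z; rewrite inE zW dz eqxx ezm => /(_ isT).
move=> [l1 [l2 [l12 [l1W _ l1t d1] [l2W _ l2t d2]]]].
have -> : s.+3 = #|midM :|: [set l1; l2]|.
  rewrite cardsU card_midM cards2 l12.
  have -> : midM :&: [set l1; l2] = set0; last by rewrite cards0 subn0 addn2.
  apply/setP => x; rewrite in_setI !in_set0 in_set2 inE; apply/negP.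
  by case/andP=> /andP[_ /eqP dx] /orP[] /eqP xl; move: dx; rewrite xl ?d1 ?d2; clear; lia.
apply: subset_leq_card; rewrite !subUset !sub1set !inE l1W l2W l1t l2t !andbT.
by apply/subsetP => x xM; rewrite inE (subsetP midM_sub) //; apply: midM_forest.
Qed.

(* Otherwise the vertices outside inN u and R, which contain Y0, would contain a cycle. *)
Lemma indeg_far u (Y0 R : {set V}) : u \in W -> u \notin forest -> Y0 \subset roots -> Y0 != set0 ->
  R \subset lowS -> (forall x, x \in lowS :\: R -> succ x \in (lowS :\: R) :|: Y0) ->
  (forall y, y \in Y0 -> ~~ e y u) -> s.+2 <= #|inN e W u| + #|R|.
Proof.
move=> uW uT sY Y00 sR hR hY; rewrite leqNgt; apply/negP => h.
have := @crit_acyc u (W :\: (inN e W u :|: R)) uW (setDS _ (subsetUl _ _)).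
have nS x : x \in lowS -> ~~ e x u.
  move=> xS; apply: contra uT => exu.
  by rewrite (succ_uniq xS uW exu); apply: succ_forest.
have inZ x : x \in (lowS :\: R) :|: Y0 -> x \in W :\: (inN e W u :|: R).
  case/setUP => [/setDP[xS xR]|xY].
    by rewrite !inE (negbTE (nS x xS)) (negbTE xR) (subsetP lowS_sub x xS).
  have xr := subsetP sY x xY; have [xT xS] := setDP xr.
  rewrite !inE (negbTE (hY x xY)) (subsetP roots_sub x xr) andbF andbT /=.
  by apply: contra xS; exact: subsetP.
apply/negP/negPn/cycP; have [y yY] := set0Pn _ Y00; split.
  by apply/set0Pn; exists y; apply: inZ; rewrite inE yY orbT.
move=> x /setDP[xW]; rewrite inE negb_or => /andP[xu xR].
have [xS|xS] := boolP (x \in lowS).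
  exists (succ x); last by have [] := succP xW.
  by apply/inZ/hR; rewrite inE xR.
have [xM|xM] := boolP (x \in midM).
  exists y; first by apply: inZ; rewrite inE yY orbT.
  by apply: midM_forest => //; have /setDP[] := subsetP sY y yY.
apply: deg_out; rewrite (deg_high xW) //.
by apply: leq_ltn_trans h; apply: (leq_card_setU _ _).1.
Qed.


Lemma succ_split x : x \in lowS -> succ x \in lowS :|: roots.
Proof. by move/succ_forest; rewrite /roots in_setU in_setD; case: (succ x \in lowS). Qed.

Lemma sum_indicator (c : nat) y :
  \sum_(x in W) c * e y x = c * deg e W y.
Proof.
rewrite -big_distrr /= /deg -sum1_card big_mkcond [in RHS]big_mkcond /=.
by congr (_ * _); apply: eq_bigr => x _; rewrite inE; case: (x \in W) => //; case: (e y x).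
Qed.

Lemma sum_forest : \sum_(x in W) (x \in forest) = #|forest|.
Proof.
rewrite -sum1_card big_mkcond [in RHS]big_mkcond /=; apply: eq_bigr => x _.
case: (boolP (x \in W)) => xW; first by case: (x \in forest).
by rewrite (contraNF (subsetP forest_sub x) xW).
Qed.

Lemma two_roots : #|roots| <> 2.
Proof.
move=> /eqP/cards2P [y1 [y2 [y12 Y]]].
pose P X := (X \subset lowS) && [forall x in X, succ x \in y1 |: X].
have [|S1 /maxsetP [/andP[sS1 /forall_inP cS1] mS1]] := @ex_maxset _ P.
  by exists set0; rewrite /P sub0set; apply/forall_inP => x; rewrite inE.
pose S2 := lowS :\: S1.
have c1 : #|S1| + #|S2| = s.-1 by rewrite -card_lowS -(cardsID S1 lowS) (setIidPr sS1).
have cS2 x : x \in S2 -> succ x \in y2 |: S2.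
  move=> /setDP[xS xS1]; apply/negPn/negP => h.
  have xx : succ x \in y1 |: S1.
    move: (succ_split xS) h; rewrite Y /S2 !(in_setU, in_set1, in_setD).
    by case: (succ x == y1) => //=; case: (succ x == y2);
      rewrite ?orbT // orbF => ->; rewrite andbT negbK.
  have := mS1 (x |: S1); rewrite subsetUr => /(_ _ isT) hE.
  suff hP : P (x |: S1) by rewrite -(hE hP) setU11 in xS1.
  apply/andP; split; first by rewrite subUset sub1set xS.
  apply/forall_inP => z /setU1P [->|/cS1].
    by move: xx; rewrite !inE => /orP[] ->; rewrite ?orbT.
  by rewrite !inE => /orP[] ->; rewrite ?orbT.
have [c cE] : exists c, c = #|S1|.+1 by exists #|S1|.+1.
have y1Y : y1 \in roots by rewrite Y !inE eqxx.
have y2Y : y2 \in roots by rewrite Y !inE eqxx orbT.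
have point u : u \in W ->
    s.+2 + (u \in forest) <= #|inN e W u| + c * e y1 u + #|S2| * e y2 u.
  move=> uW; have [/indeg_forest|uT] := boolP (u \in forest); first by lia.
  have [eu1|eu1] := boolP (e y1 u); have [eu2|eu2] := boolP (e y2 u).
  - by have := crit_indeg uW; lia.
  - have := @indeg_far u [set y2] S1 uW uT; rewrite sub1set y2Y => /(_ isT) h.
    suff: s.+2 <= #|inN e W u| + #|S1| by move: cE; clear; lia.
    apply: h => // [|x xS2|y /set1P -> //].
      by apply/set0Pn; exists y2; rewrite set11.
    by rewrite setUC; apply: cS2.
  - have := @indeg_far u [set y1] S2 uW uT; rewrite sub1set y1Y => /(_ isT) h.
    suff: s.+2 <= #|inN e W u| + #|S2| by move: cE; clear; lia.
    have SS : lowS :\: S2 = S1 by rewrite setDDr setDv set0U (setIidPr sS1).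
    apply: h => // [|||y /set1P -> //]; rewrite ?SS.
    + by apply/set0Pn; exists y1; rewrite set11.
    + exact: subsetDl.
    + by move=> x xS; rewrite setUC; apply: cS1.
  - have := @indeg_far u roots set0 uW uT (subxx _); rewrite cards0.
    suff: forall y, y \in roots -> ~~ e y u.
      move=> hy /(_ roots_neq0 (sub0set _)) h; have := h _ hy.
      suff hx x : x \in lowS :\: set0 -> succ x \in lowS :\: set0 :|: roots.
        by move=> /(_ hx); lia.
      by rewrite setD0; apply: succ_split.
    by move=> y; rewrite Y => /set2P [] ->.
have := leq_sum (index_enum V) point; rewrite !big_split /= sum_forest !sum_indicator.
rewrite (deg_roots y1Y) (deg_roots y2Y) sum_nat_const.
have cT : #|forest| = s.+1.
  have := cardsID lowS forest; rewrite (setIidPr (subsetUl _ _)) card_lowS -/roots Y cards2 y12.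
  by have := crit_gt0 cr; lia.
have c3 : c * s.+2 + #|S2| * s.+2 = s * s.+2 by rewrite -mulnDl; congr (_ * _); lia.
have c4 : #|W| * s.+2 = s.+2 * #|W| by rewrite mulnC.
have c5 : s * s.+2 = s * s.+1 + s by rewrite mulnS addnC.
by have := crit_sum; rewrite cT; move: c3 c4 c5; lia.
Qed.

Lemma one_root : #|roots| <> 1.
Proof.
move=> /eqP/cards1P [y Y].
have yY : y \in roots by rewrite Y set11.
have yW := subsetP roots_sub _ yY.
have yT : y \in forest by case/setDP: yY.
have point u : u \in W ->
    s.+2 + (u \in forest) <= #|inN e W u| + s * e y u.
  move=> uW; have [/indeg_forest|uT] := boolP (u \in forest); first by lia.
  have [eu|eu] := boolP (e y u); first by have := crit_indeg uW; lia.
  have := @indeg_far u roots set0 uW uT (subxx _); rewrite cards0.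
  move=> /(_ roots_neq0 (sub0set _)) h.
  suff : s.+2 <= #|inN e W u| + 0 by lia.
  apply: h => [x|z]; first by rewrite setD0; apply: succ_split.
  by rewrite Y => /set1P ->.
have cT : #|forest| = s.
  have := cardsID lowS forest; rewrite (setIidPr (subsetUl _ _)) card_lowS -/roots Y cards1.
  by have := crit_gt0 cr; lia.
(* Summed over W, the inequalities [point] become an equality. *)
have tight u : u \in W -> #|inN e W u| + s * e y u = s.+2 + (u \in forest).
  move=> uW; apply/eqP; rewrite eqn_leq point // andbT leqNgt; apply/negP => hu.
  have : \sum_(x in W) (s.+2 + (x \in forest)) < \sum_(x in W) (#|inN e W x| + s * e y x).
    rewrite (big_setD1 u uW) [X in _ < X](big_setD1 u uW) /= -addSn leq_add //.
    by apply: leq_sum => x /setD1P [_ /point].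
  rewrite !big_split /= sum_forest sum_indicator (deg_roots yY) sum_nat_const cT.
  by have := crit_sum; nia.
have yu u : u \in W -> e y u -> u \notin forest /\ #|inN e W u| = 2.
  move=> uW eu; have := tight u uW; rewrite eu muln1.
  by have [/indeg_forest|] := boolP (u \in forest); [have := crit_gt0 cr; lia|split=> //; lia].
have loopy := crit_loop cr yW.
have cy : #|inN e W y| = s.+3 by have := tight y yW; rewrite (negbTE loopy) yT; lia.
pose R := [set p in W | e p y && e y p].
have pred u : u \in W -> e y u -> exists p, p \in R /\ inN e W u = [set y; p].
  move=> uW eu; have [_ c2] := yu u uW eu.
  have [p pW /andP[epy epu]] := crit_common cr yW uW eu.
  have py := crit_neq pW epy.
  have inu : inN e W u = [set y; p].
    apply/esym/eqP; rewrite eqEcard cards2 eq_sym py c2 andbT subUset !sub1set !inE.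
    by rewrite yW pW eu epu.
  exists p; split=> //; rewrite inE pW epy /=.
  have [z zW /andP[ezp ezu]] := crit_common cr pW uW epu.
  have : z \in inN e W u by rewrite inE zW.
  rewrite inu => /set2P [zy|zp]; first by rewrite -{1}zy.
  by have := crit_neq zW ezp; rewrite zp eqxx.
have sR : R \subset W by apply/subsetP => x; rewrite inE => /andP[].
have predR r : r \in R -> exists p, p \in R /\ inN e W r = [set y; p].
  by rewrite inE => /and3P[rW _ /pred]; apply.
have RM : R :&: midM = set0.
  apply/eqP/negPn/negP => RM0.
  have RMa B : B \subset R :&: midM -> ~~ cyc e B.
    by move=> sB; apply: midM_acyc (subset_trans sB (subsetIr _ _)).
  have [m /setIP [mR mM] ms] := acyc_source RM0 RMa.
  have [p [pR inm]] := predR m mR.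
  have mW := subsetP sR m mR.
  have dm : deg e W m = s.+1 by move: mM; rewrite inE => /andP[_ /eqP].
  have isp z : z \in W -> e z m -> e z y -> z = p.
    move=> zW ezm ezy; have : z \in inN e W m by rewrite inE zW.
    rewrite inm => /set2P [zy|//]; by rewrite zy (negbTE loopy) in ezy.
  case: (crit_commonM cr mW yW (midM_forest mM yT) dm) => [[z [zW dz ezm ezy]]|].
    have zp := isp z zW ezm ezy; have := ms z; rewrite ezm !inE zW dz eqxx ezy /=.
    suff -> : e y z by move=> /(_ isT).
    by move: pR; rewrite -zp inE => /and3P[].
  move=> [l1 [l2 [/eqP l12 [l1W l1m l1y _] [l2W l2m l2y _]]]]; apply: l12.
  by rewrite (isp l1) // (isp l2).
have R0 : R != set0.
  have /card_gt0P [u] := crit_deg_ge1 cr yW; rewrite inE => /andP[uW eu].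
  by have [p [pR _]] := pred u uW eu; apply/set0Pn; exists p.
have R2 : #|R| <= 2.
  have -> : 2 = #|inN e W y :\: midM|.
    have sM : midM \subset inN e W y.
      by apply/subsetP => m mM; rewrite inE (subsetP midM_sub) // midM_forest.
    by rewrite cardsD (setIidPr sM) cy card_midM; lia.
  apply: subset_leq_card; apply/subsetP => r rR; rewrite in_setD; apply/andP; split.
    by apply/negP => rM; have := in_set0 r; rewrite -RM in_setI rR rM.
  by move: rR; rewrite !inE => /and3P[-> ->].
have [r rR|B sB cB] := @indeg_cyc _ e R R0.
  have [p [pR inr]] := predR r rR; exists p => //.
  have : p \in inN e W r by rewrite inr set22.
  by rewrite inE => /andP[].
have := disjoint_cyc (crit_two_cyc cr) (subset_trans sB sR) cB (setDS _ sB).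
apply/negP/negPn/cycP; split.
  by apply/set0Pn; exists y; rewrite !inE yW (negbTE loopy).
move=> x /setDP[xW xR]; have [xS|xS] := boolP (x \in lowS).
  have [fW ef] := succP xW; exists (succ x) => //; rewrite inE fW andbT.
  apply/negP; rewrite inE => /and3P[_ _ /(yu _ fW) [/negP]].
  by have := succ_forest xS.
apply: deg_out; apply: leq_ltn_trans R2 _.
by move: xS s_gt1; rewrite inE xW /= -ltnNge; clear; lia.
Qed.

Lemma critical_gt1_false : False.
Proof.
have := card_roots; have : 0 < #|roots| by rewrite card_gt0 roots_neq0.
by have := two_roots; have := one_root; case: #|roots| => [|[|[|]]].
Qed.

End Critical.

(** * Critical digraphs with s = 1 *)

Section CriticalOne.
Context {V : finType} (e : rel V) (W : {set V}) (cr : critical e W 1).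

Lemma cyc2 x y : e x y -> e y x -> cyc e [set x; y].
Proof.
move=> exy eyx; apply/cycP; split; first by apply/set0Pn; exists x; rewrite set21.
by move=> z /set2P [] ->; [exists y => //; rewrite set22|exists x => //; rewrite set21].
Qed.

Lemma no_pair_2cycles x1 x2 x3 x4 : all (mem W) [:: x1; x2; x3; x4] ->
  uniq [:: x1; x2; x3; x4] -> e x1 x2 -> e x2 x1 -> e x3 x4 -> e x4 x3 -> False.
Proof.
move=> /= /and5P[w1 w2 w3 w4 _] un e12 e21 e34 e43; apply: (crit_two_cyc cr).
exists [set x1; x2], [set x3; x4]; split; try exact: cyc2.
- by rewrite subUset !sub1set w1.
- by rewrite subUset !sub1set w3.
- rewrite -setI_eq0; apply/eqP/setP => z; rewrite !inE.
  by apply/negP => /andP[/orP[] /eqP -> /orP[] /eqP xE];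
    move: un; rewrite /= !inE xE eqxx ?orbT ?andbF.
Qed.

Lemma two_outs x : x \in W ->
  exists y1 y2, [/\ y1 \in W, y2 \in W, y1 != y2, e x y1 & e x y2].
Proof.
move=> xW; have : 1 < deg e W x.
  have := crit_degS cr xW; have := crit_deg_ge1 cr xW; have cS := crit_cntS cr.
  rewrite ltnNge => d1; move=> _; apply/negP => d2.
  have := cards0_eq cS; move/setP/(_ x); rewrite !inE xW; lia.
by move/card_gt1P => [y1 [y2 [+ + ?]]]; rewrite !inE => /andP[? ?] /andP[? ?]; exists y1, y2.
Qed.

Lemma outs_le3 x t : x \in W -> uniq t -> all (fun y => (y \in W) && e x y) t -> size t <= 3.
Proof.
move=> xW ut /allP at_; apply: leq_trans (crit_degL cr xW).
rewrite -(card_uniqP ut); apply: subset_leq_card; apply/subsetP => y /at_.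
by rewrite inE.
Qed.

Lemma outs_third x p q w w' : x \in W -> p \in W -> q \in W -> w \in W -> w' \in W ->
  e x p -> e x q -> e x w -> e x w' -> p != q -> w != p -> w != q -> w' != p -> w' != q -> w' = w.
Proof.
move=> xW pW qW wW w'W xp xq xw xw' pq wp wq w'p w'q; apply/eqP/negPn/negP => ww.
have := @outs_le3 x [:: p; q; w; w'] xW.
rewrite /= !inE pW qW wW w'W xp xq xw xw' [p == w]eq_sym [p == w']eq_sym.
rewrite [q == w]eq_sym [q == w']eq_sym [w == w']eq_sym (negbTE pq).
by rewrite (negbTE wp) (negbTE w'p) (negbTE wq) (negbTE w'q) (negbTE ww) => /(_ isT isT).
Qed.

Lemma exists_indeg2 : exists2 u, u \in W & #|inN e W u| = 2.
Proof.
have [/exists_inP [u uW /eqP]|/exists_inPn h] := boolP [exists u in W, #|inN e W u| == 2].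
  by exists u.
have : \sum_(x in W) 3 <= \sum_(x in W) #|inN e W x|.
  by apply: leq_sum => x xW; have := h x xW; have := crit_indeg cr xW; lia.
by have := crit_sum cr; rewrite sum_nat_const; lia.
Qed.

Section Config.
Variables a b u : V.
Hypotheses (aW : a \in W) (bW : b \in W) (uW : u \in W) (ab : e a b) (ba : e b a).
Hypothesis inu : inN e W u = [set a; b].

Let eau : e a u. Proof. by have := set21 a b; rewrite -inu inE => /andP[]. Qed.
Let ebu : e b u. Proof. by have := set22 a b; rewrite -inu inE => /andP[]. Qed.
Let nab : a != b. Proof. exact: (crit_neq cr aW ab). Qed.
Let nau : a != u. Proof. exact: (crit_neq cr aW eau). Qed.
Let nbu : b != u. Proof. exact: (crit_neq cr bW ebu). Qed.
Let lp x : x \in W -> e x x = false. Proof. by move=> xW; apply/negbTE; exact: (crit_loop cr). Qed.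

Let acyc2 x y : x \in W -> y \in W -> x != a -> x != b -> y != a -> y != b ->
  e x y -> e y x -> False.
Proof.
move=> xW yW xa xb ya yb exy eyx; have := @crit_acyc _ _ _ _ cr u [set x; y] uW.
rewrite cyc2 // subUset !sub1set inu !inE xW yW (negbTE xa) (negbTE xb) (negbTE ya) (negbTE yb).
by move=> /(_ isT).
Qed.

Let into_u x : x \in W -> e x u -> x = a \/ x = b.
Proof. by move=> xW exu; apply/set2P; rewrite -inu inE xW. Qed.

Lemma dominated w : w \in W -> e a w || e b w.
Proof.
move=> wW; apply/negPn/negP; rewrite negb_or => /andP[na nb].
have [B sB cB] := crit_inN_cyc cr wW.
have := @crit_acyc _ _ _ _ cr u B uW; rewrite cB => /(_ _)/negP; apply => //.
apply/subsetP => x /(subsetP sB); rewrite inu !inE => /andP[-> exw]; rewrite andbT.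
by apply/norP; split; [apply: contraNneq na => <-|apply: contraNneq nb => <-].
Qed.

Let a_third w w' : w \in W -> w' \in W -> e a w -> e a w' ->
  w != b -> w != u -> w' != b -> w' != u -> w' = w.
Proof.
by move=> wW w'W aw aw' wb wu w'b w'u; apply: (@outs_third a b u w w').
Qed.

Let b_third w w' : w \in W -> w' \in W -> e b w -> e b w' ->
  w != a -> w != u -> w' != a -> w' != u -> w' = w.
Proof.
by move=> wW w'W aw aw' wb wu w'b w'u; apply: (@outs_third b a u w w').
Qed.

Lemma to_ab w : w \in W -> w != a -> w != b ->
  (forall x, x \in W -> e w x -> x = a \/ x = b) -> e w a /\ e w b.
Proof.
move=> wW wa wb h; have [y1 [y2 [y1W y2W y12 e1 e2]]] := two_outs wW.
by case: (h y1 y1W e1) (h y2 y2W e2) => y1E [] y2E; subst; rewrite ?eqxx in y12.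
Qed.

Lemma not_both w : w \in W -> w != a -> w != b -> w != u -> e a w -> e b w -> False.
Proof.
move=> wW wa wb wu aw bw.
have hW x : x \in W -> [\/ x = a, x = b, x = u | x = w].
  move=> xW; have [->|xa] := eqVneq x a; first by constructor.
  have [->|xb] := eqVneq x b; first by constructor.
  have [->|xu] := eqVneq x u; first by constructor.
  by constructor; case/orP: (dominated xW) => ?; [apply: a_third|apply: b_third].
have [ea eb] : e w a /\ e w b.
  apply: to_ab => // x xW ewx; case: (hW x xW) => xE; [by left|by right| |].
    by rewrite xE in ewx; case: (into_u wW ewx) => wE; rewrite wE eqxx in wa wb.
  by rewrite xE lp in ewx.
have [y1 [y2 [y1W y2W y12 e1 e2]]] := two_outs uW.
have hu y : y \in W -> e u y -> [\/ y = a, y = b | y = w].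
  move=> yW uy; case: (hW y yW) => yE; try by constructor.
  by rewrite yE lp in uy.
have [] : e u a \/ e u b.
  by case: (hu y1 y1W e1) (hu y2 y2W e2) => y1E [] y2E; subst; rewrite ?eqxx in y12; auto.
- move=> ua; apply: (@no_pair_2cycles u a w b) => //=; first by rewrite uW aW wW bW.
  rewrite !inE [u == a]eq_sym [u == w]eq_sym [u == b]eq_sym [a == w]eq_sym.
  by rewrite (negbTE nau) (negbTE wu) (negbTE nbu) (negbTE wa) (negbTE nab) (negbTE wb).
- move=> ub; apply: (@no_pair_2cycles u b w a) => //=; first by rewrite uW aW wW bW.
  rewrite !inE [u == a]eq_sym [u == w]eq_sym [u == b]eq_sym [b == w]eq_sym [b == a]eq_sym.
  by rewrite (negbTE nau) (negbTE wu) (negbTE nbu) (negbTE wa) (negbTE nab) (negbTE wb).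
Qed.

Lemma not_only_a w : w \in W -> w != a -> w != b -> w != u -> e a w -> ~~ e b w -> False.
Proof.
move=> wW wa wb wu aw nbw.
have [z zW /andP[za zw]] := crit_common cr aW wW aw.
have nza := crit_neq cr zW za; have nzw := crit_neq cr zW zw.
have nzb : z != b by apply: contraNneq nbw => <-.
have a_only x : x \in W -> e a x -> x != w -> x = b \/ x = u.
  move=> xW ax xw; have [->|xb] := eqVneq x b; first by left.
  have [->|xu] := eqVneq x u; first by right.
  by case/eqP: xw; apply: a_third.
have other w' : w' \in W -> w' != a -> w' != b -> w' != u -> w' != w ->
    [/\ ~~ e a w', e b w' & forall x, x \in W -> [\/ x = a, x = b, x = u | x = w \/ x = w']].
  move=> w'W w'a w'b w'u w'w.
  have naw' : ~~ e a w'.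
    by apply/negP => aw'; case: (a_only w' w'W aw' w'w) => w'E; rewrite w'E eqxx in w'b w'u.
  have bw' : e b w' by move: (dominated w'W); rewrite (negbTE naw').
  split=> // x xW; have [->|xa] := eqVneq x a; first by constructor.
  have [->|xb] := eqVneq x b; first by constructor.
  have [->|xu] := eqVneq x u; first by constructor.
  by constructor; case/orP: (dominated xW) => ?; [left; apply: a_third|right; apply: b_third].
have nou x : x \in W -> x != a -> x != b -> e x u = false.
  by move=> xW xa xb; apply/negP => /(into_u xW) [] xE; rewrite xE eqxx in xa xb.
have pairs x y : x \in W -> y \in W -> x != a -> x != b -> y != a -> y != b -> x != y ->
    e a x -> e x a -> e b y -> e y b -> False.
  move=> xW yW xa xb ya yb xy ax xa' by_ yb'.
  apply: (@no_pair_2cycles a x b y) => //=; first by rewrite aW xW bW yW.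
  rewrite !inE [a == x]eq_sym [a == y]eq_sym [b == y]eq_sym.
  by rewrite (negbTE xa) (negbTE nab) (negbTE ya) (negbTE xb) (negbTE xy) (negbTE yb).
have [ua' ub'] : u != a /\ u != b by rewrite eq_sym nau eq_sym nbu.
have [zu|zu] := eqVneq z u; last first.
  have [naz bz hW] := other z zW nza nzb zu nzw.
  have [z' z'W /andP[z'b z'z]] := crit_common cr bW zW bz.
  have z'u : z' = u.
    case: (hW z' z'W) => // [z'E|z'E|[z'E|z'E]]; rewrite z'E in z'b z'z.
    - by rewrite z'z in naz.
    - by rewrite lp in z'b.
    - by case: (@acyc2 w z).
    - by rewrite lp in z'z.
  rewrite z'u in z'b z'z; have [ewa ewb] : e w a /\ e w b.
    apply: to_ab => // x xW wx; case: (hW x xW) => [xE|xE|xE|[xE|xE]]; rewrite ?xE in wx *.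
    - by left.
    - by right.
    - by rewrite nou in wx.
    - by rewrite lp in wx.
    - by case: (@acyc2 w z).
  by apply: (pairs w u).
rewrite {z zW nza nzb}zu in za zw nzw.
have [/exists_inP [w' w'W /and4P[w'a w'b w'u w'w]]|/exists_inPn h] :=
    boolP [exists x in W, [&& x != a, x != b, x != u & x != w]].
  have [naw' bw' hW] := other w' w'W w'a w'b w'u w'w.
  have [z' z'W /andP[z'b z'w']] := crit_common cr bW w'W bw'.
  have z'w : z' = w.
    case: (hW z' z'W) => // [z'E|z'E|z'E|[//|z'E]]; rewrite z'E in z'b z'w'.
    - by rewrite z'w' in naw'.
    - by rewrite lp in z'b.
    - have := @outs_le3 u [:: a; b; w; w'] uW; rewrite /= !inE aW bW wW w'W za z'b zw z'w'.
      rewrite [a == w]eq_sym [b == w]eq_sym [a == w']eq_sym [b == w']eq_sym [w == w']eq_sym.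
      rewrite (negbTE nab) (negbTE wa) (negbTE w'a) (negbTE wb) (negbTE w'b) (negbTE w'w).
      by move=> /(_ isT isT).
    - by rewrite lp in z'w'.
  rewrite z'w in z'b z'w'; have [ewa ewb] : e w' a /\ e w' b.
    apply: to_ab => // x xW wx; case: (hW x xW) => [xE|xE|xE|[xE|xE]]; rewrite ?xE in wx *.
    - by left.
    - by right.
    - by rewrite nou in wx.
    - by case: (@acyc2 w w').
    - by rewrite lp in wx.
  by apply: (pairs u w') => //; rewrite eq_sym.
have hW x : x \in W -> [\/ x = a, x = b, x = u | x = w].
  move=> xW; have := h x xW; rewrite !negb_and !negbK => /or4P [] /eqP; by constructor.
have [ewa ewb] : e w a /\ e w b.
  apply: to_ab => // x xW wx; case: (hW x xW) => xE; rewrite ?xE in wx *.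
  - by left.
  - by right.
  - by rewrite nou in wx.
  - by rewrite lp in wx.
have [ub|nub] := boolP (e u b); first by apply: (pairs w u).
have d2 x p q : x \in W -> (forall y, y \in W -> e x y -> y = p \/ y = q) -> x \in midM e W 1.
  move=> xW hx; rewrite inE xW /= eqn_leq; apply/andP; split.
    apply: (@leq_trans #|[set p; q]|); last by rewrite cards2; case: (_ != _).
    apply: subset_leq_card; apply/subsetP => y; rewrite !inE.
    by case/andP => yW /(hx y yW) [] ->; rewrite eqxx ?orbT.
  have [y1 [y2 [? ? y12 ? ?]]] := two_outs xW.
  by apply/card_gt1P; exists y1, y2; rewrite !inE; split=> //; apply/andP.
have : #|[set u; b; w]| <= #|midM e W 1|.
  apply: subset_leq_card; rewrite !subUset !sub1set; apply/andP; split; last first.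
    apply: (@d2 w a b) => // y yW wy; case: (hW y yW) => yE; rewrite yE in wy *; auto.
      by rewrite nou in wy.
    by rewrite lp in wy.
  apply/andP; split.
    apply: (@d2 u a w) => // y yW wy; case: (hW y yW) => yE; rewrite yE in wy *; auto.
      by rewrite wy in nub.
    by rewrite lp in wy.
  apply: (@d2 b a u) => // y yW wy; case: (hW y yW) => yE; rewrite yE in wy *; auto.
    by rewrite lp in wy.
  by rewrite wy in nbw.
rewrite (card_midM cr) -setUA cardsU1 cards2 !inE [u == b]eq_sym [u == w]eq_sym [b == w]eq_sym.
by rewrite (negbTE nbu) (negbTE wu) (negbTE wb).
Qed.

End Config.

Lemma critical_eq1_false : False.
Proof.
have [u uW /eqP/cards2P [a [b [nab inu]]]] := exists_indeg2.
have inW x : x \in inN e W u -> x \in W /\ e x u by rewrite inE => /andP.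
have [aW au] : a \in W /\ e a u by apply: inW; rewrite inu set21.
have [bW bu] : b \in W /\ e b u by apply: inW; rewrite inu set22.
have ba : e b a.
  have [z zW /andP[za zu]] := crit_common cr aW uW au.
  have /set2P [zE|<-//] : z \in [set a; b] by rewrite -inu inE zW.
  by have := crit_neq cr zW za; rewrite zE eqxx.
have ab : e a b.
  have [z zW /andP[za zu]] := crit_common cr bW uW bu.
  have /set2P [<-//|zE] : z \in [set a; b] by rewrite -inu inE zW.
  by have := crit_neq cr zW za; rewrite zE eqxx.
have inu' : inN e W u = [set b; a] by rewrite setUC.
have nau := crit_neq cr aW au; have nbu := crit_neq cr bW bu.
have c3 : #|[set a; b; u]| = 3.
  by rewrite setUC cardsU1 cards2 !inE ![u == _]eq_sym (negbTE nau) (negbTE nbu) nab.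
have [/exists_inP [w wW /and3P[wa wb wu]]|/exists_inPn h] :=
    boolP [exists x in W, [&& x != a, x != b & x != u]].
  have [aw|naw] := boolP (e a w); have [bw|nbw] := boolP (e b w).
  - exact: (@not_both a b u aW bW uW ab ba inu w).
  - exact: (@not_only_a a b u aW bW uW ab ba inu w).
  - exact: (@not_only_a b a u bW aW uW ba ab inu' w).
  - by have := @dominated a b u uW inu w wW; rewrite (negbTE naw) (negbTE nbw).
have WE : W = [set a; b; u].
  apply/eqP; rewrite eqEsubset !subUset !sub1set aW bW uW !andbT.
  apply/subsetP => x xW; have := h x xW; rewrite !negb_and !negbK !inE.
  by case/or3P => ->; rewrite ?orbT.
have : #|W| <= #|midM e W 1|.
  apply: subset_leq_card; apply/subsetP => x xW; rewrite inE xW /= eqn_leq.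
  have -> : deg e W x <= 2 by rewrite -ltnS -c3 -WE; apply: deg_lt => //; apply: (crit_loop cr).
  have [y1 [y2 [? ? y12 ? ?]]] := two_outs xW.
  by apply/card_gt1P; exists y1, y2; rewrite !inE; split=> //; apply/andP.
by rewrite (card_midM cr) WE c3.
Qed.

End CriticalOne.

(** * Large sequences force two disjoint cycles *)

Section LargeSufficient.
Context {V : finType}.
Implicit Types (e : rel V) (W B : {set V}).

Lemma two_cyc_dec e W : decidable (two_cyc e W).
Proof.
apply: (@decP _ [exists B1 : {set V}, exists B2 : {set V},
  [&& B1 \subset W, B2 \subset W, cyc e B1, cyc e B2 & [disjoint B1 & B2]]]).
apply: (iffP existsP) => [[B1 /existsP [B2 /and5P[? ? ? ? ?]]]|[B1 [B2 [? ? ? ? ?]]]].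
  by exists B1, B2.
by exists B1; apply/existsP; exists B2; apply/and5P.
Qed.

Lemma critical_false e W s : ~ critical e W s.
Proof.
move=> cr; have [s1|s1] := ltnP 1 s; first exact: critical_gt1_false cr s1.
have s1' : s = 1 by have := crit_gt0 cr; lia.
by rewrite s1' in cr; exact: critical_eq1_false cr.
Qed.

Lemma large_on_two_cyc e W : large_on e W -> two_cyc e W.
Proof.
have [k] := ubnP (mu e W); elim: k e W => // k IH e W; rewrite ltnS => hk g.
have [//|nT] := two_cyc_dec e W.
have mW : mincex e W.
  by split=> // e' W' m'; apply: IH; apply: leq_trans hk.
have nA s : ~ largeA e W s.
  by move=> lA; have [s' cr] := mincex_critical mW lA; exact: critical_false cr.
have [s [s0 sW d1 cs [c2|[j [? ? ?]]]]] := mincex_mindeg mW g.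
  by case: (nA s).
by case: (mincex_not_largeB (s := s) (j := j) mW nA).
Qed.

Lemma cyc_dicycle e B : cyc e B -> exists2 c, is_dicycle e c & {subset c <= B}.
Proof.
move=> /cycP [/set0Pn [x0 x0B] h].
pose g x := odflt x [pick y in B | e x y].
have gP x : x \in B -> g x \in B /\ e x (g x).
  move=> /h [y yB exy]; rewrite /g; case: pickP => [z /andP[] //|/(_ y)].
  by rewrite /= yB exy.
have itB n : iter n g x0 \in B by elim: n => //= n /gP [].
have [i [j [ij eij]]] : exists i j, i < j /\ iter i g x0 = iter j g x0.
  have /injectivePn [i [j nij eij]] : ~~ injectiveb (fun i : 'I_#|V|.+1 => iter i g x0).
    by apply/negP => /injectiveP /leq_card; rewrite card_ord ltnn.
  case: (ltngtP i j) => ij; [by exists i, j|by exists j, i|].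
  by case/eqP: nij; apply: val_inj.
have zz : iter (j - i.+1).+1 g (iter i g x0) = iter i g x0.
  by rewrite -iterD eij; have -> : (j - i.+1).+1 + i = j by lia.
pose z := iter i g x0.
have oB : {subset orbit g z <= B}.
  by move=> y /trajectP [k _ ->]; rewrite -iterD.
exists (orbit g z) => //; split.
  by rewrite /orbit -orderSpred.
rewrite /ucycle orbit_uniq andbT.
have : fcycle g (orbit g z) by apply/(orbitPcycle 0 3); exists (j - i.+1).
have eg : {in mem B &, subrel (frel g) e}.
  by move=> x y xB _ /= /eqP <-; have [] := gP x xB.
by apply: (sub_in_cycle eg); apply/allP.
Qed.

Lemma dicycle_cyc e c : is_dicycle e c -> cyc e [set x in c].
Proof.
move=> [c0 /andP[cc _]]; apply/cycP; split.
  by case: c c0 {cc} => // x c _; apply/set0Pn; exists x; rewrite inE mem_head.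
move=> x; rewrite inE => xc; exists (next c x); first by rewrite inE mem_next.
exact: next_cycle.
Qed.

Lemma two_cyc_has e : two_cyc e setT <-> has_two_disjoint_cycles e.
Proof.
split=> [[B1 [B2 [_ _ /cyc_dicycle [c1 d1 s1] /cyc_dicycle [c2 d2 s2] dB]]]|[c1 [c2 [d1 d2 dc]]]].
  exists c1, c2; split=> //; apply: disjointWl (_ : c1 \subset B1) _; first exact/subsetP.
  by apply: disjointWr dB; apply/subsetP.
exists [set x in c1], [set x in c2]; rewrite !subsetT !dicycle_cyc //; split=> //.
rewrite -setI_eq0; apply/eqP/setP => x; rewrite !inE.
by apply/andP => [[x1]]; rewrite (disjointFr dc x1).
Qed.

End LargeSufficient.

Lemma leq_entry d i k : sorted leq d -> 0 < i <= size d ->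
  (k <= entry d i) = (count (fun x => x < k) d < i).
Proof.
move=> sd /andP[i0 id_].
have mono a b : a <= b -> b < size d -> nth 0 d a <= nth 0 d b.
  by move=> ab bd; apply: (sorted_leq_nth leq_trans leqnn) => //; rewrite inE; lia.
rewrite /entry; have [h|h] := leqP k (nth 0 d i.-1); apply/esym.
  rewrite -(cat_take_drop i.-1 d) count_cat.
  have -> : count (fun x => x < k) (drop i.-1 d) = 0.
    apply/eqP; rewrite -leqn0 leqNgt -has_count -all_predC; apply/(all_nthP 0) => j.
    rewrite size_drop => jd /=; rewrite nth_drop -leqNgt; apply: leq_trans h _.
    by apply: mono; lia.
  rewrite addn0; apply: leq_ltn_trans (count_size _ _) _; rewrite size_take; case: ifP; lia.
apply/negbTE; rewrite -leqNgt -[in X in _ <= X](cat_take_drop i d) count_cat.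
apply: leq_trans (leq_addr _ _).
have /eqP -> : count (fun x => x < k) (take i d) == size (take i d).
  rewrite -all_count; apply/(all_nthP 0) => j.
  rewrite size_takel // => ji; rewrite nth_take //; apply: leq_ltn_trans h.
  by apply: mono; lia.
by rewrite size_takel.
Qed.

Lemma cnt_setT (V : finType) (e : rel V) k :
  cnt e setT k = count (fun x => x < k) (outdeg_seq e).
Proof.
rewrite /outdeg_seq (permP (permEl (perm_sort _ _))) count_map /cnt cardE -size_filter.
rewrite /enum_mem -filter_predI; congr size; apply: eq_filter => x /=.
rewrite !inE /= andbT; congr (_ < _); apply: eq_card => y; by rewrite !inE.
Qed.

Lemma large_large_on (V : finType) (e : rel V) : large (outdeg_seq e) -> large_on e setT.
Proof.
set d := outdeg_seq e.
have sd : sorted leq d by apply: sort_sorted; exact: leq_total.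
have szd : size d = #|V| by rewrite size_sort size_map cardE.
move=> [r [s [[r0 rs sn] [[dr ds] h]]]]; exists r, s; rewrite cardsT -szd.
split=> //; rewrite !cnt_setT -/d; split.
- by rewrite -leq_entry //; lia.
- by rewrite -leq_entry //; lia.
- have [h2|h2] := leqP (2 * s - r + 2) (size d); last first.
    by left; apply: leq_ltn_trans (count_size _ _) h2.
  have [he|he] := eqVneq (entry d (2 * s - r + 2)) (s + 1).
    have [j [j1 [j2 j3]]] := h h2 he; right; exists j; split=> //.
    by rewrite cnt_setT -/d -leq_entry //; lia.
  left; rewrite -leq_entry //; last by lia.
  suff : entry d s <= entry d (2 * s - r + 2) by lia.
  by apply: (sorted_leq_nth leq_trans leqnn) => //; rewrite ?inE; lia.
Qed.

(** * Digraphs without two disjoint cycles *)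

Lemma outdeg_seq_ord d (e : rel 'I_(size d)) : sorted leq d ->
  (forall i : 'I_(size d), outdeg e i = nth 0 d i) -> outdeg_seq e = d.
Proof.
move=> sd h; rewrite /outdeg_seq (eq_map h) (map_comp (nth 0 d) val) val_enum_ord.
by rewrite -/(mkseq (nth 0 d) (size d)) mkseq_nth; apply: sorted_sort => //; exact: leq_trans.
Qed.

Lemma card_ord_itv n a b : a <= b -> b <= n -> #|[set j : 'I_n | a <= j < b]| = b - a.
Proof.
move=> ab bn; transitivity (count (fun j => a <= j < b) (iota 0 n)).
  rewrite -sum1_card -sum1_count (_ : iota 0 n = index_iota 0 n) ?big_mkord.
    by apply: eq_bigl => j; rewrite inE.
  by rewrite /index_iota subn0.
have -> : iota 0 n = iota 0 a ++ iota a (b - a) ++ iota b (n - b).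
  by rewrite -{2}(subnKC ab) -iotaD -{2}(add0n a) -iotaD; congr iota; lia.
rewrite !count_cat.
have -> : count (fun j => a <= j < b) (iota 0 a) = 0.
  by apply/eqP; rewrite -leqn0 leqNgt -has_count; apply/hasPn => j; rewrite mem_iota; lia.
have -> : count (fun j => a <= j < b) (iota b (n - b)) = 0.
  by apply/eqP; rewrite -leqn0 leqNgt -has_count; apply/hasPn => j; rewrite mem_iota; lia.
rewrite addn0 add0n -[RHS](size_iota a); apply/eqP; rewrite -all_count.
by apply/allP => j; rewrite mem_iota; lia.
Qed.

Lemma card_ord_lt n k : k <= n -> #|[set j : 'I_n | j < k]| = k.
Proof. by move=> kn; have := @card_ord_itv n 0 k isT kn; rewrite subn0. Qed.

Lemma cyc_min n (e : rel 'I_n) B : cyc e B ->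
  exists2 i, i \in B & (forall j, j \in B -> i <= j) /\ exists2 j, j \in B & e i j.
Proof.
move=> /cycP [/set0Pn [x xB] h]; have [i iB mi] := @arg_minnP _ x (mem B) val xB.
by exists i => //; split => //; exact: h.
Qed.

Lemma no_large_acyclic d : 0 < size d -> sorted leq d ->
  (forall i, i < size d -> nth 0 d i <= i.+1) ->
  exists e : rel 'I_(size d), outdeg_seq e = d /\ ~ has_two_disjoint_cycles e.
Proof.
move=> d0 sd h; pose D := nth 0 d.
have ln : (size d).-1 < size d by lia.
pose l := Ordinal ln.
pose e : rel 'I_(size d) := fun i j => if D i <= i then j < D i else (j < i) || (j == l).
exists e; split.
  apply: outdeg_seq_ord => // i; rewrite /outdeg -/(D i); have hi := h i (ltn_ord i).
  have [di|di] := leqP (D i) i.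
    rewrite -[RHS](@card_ord_lt (size d)); last by have := ltn_ord i; lia.
    by apply: eq_card => j; rewrite !inE /e di.
  have -> : D i = i.+1 by move: hi di; rewrite /D; lia.
  rewrite -[in RHS](@card_ord_lt (size d) i); last by apply: ltnW.
  transitivity #|l |: [set j : 'I_(size d) | j < i]|.
    by apply: eq_card => j; rewrite !inE /e leqNgt di /= orbC.
  rewrite cardsU1 inE /= (_ : _ < i = false) //.
  by apply/negbTE; rewrite -leqNgt; have := ltn_ord i; lia.
move=> /two_cyc_has [B1 [B2 [_ _ c1 c2 dB]]].
have inl B : cyc e B -> l \in B.
  case/cyc_min => i iB [mi [j jB]]; have := mi j jB; rewrite /e => ij.
  case: ifP => di; first by lia.
  by case/orP => [|/eqP <-//]; lia.
by have := disjointFr dB (inl _ c1); rewrite inl.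
Qed.

Lemma rim_closed n s c (i : 'I_n) (B : {set 'I_n}) : c <= n -> s <= i < c -> i \in B ->
  (forall k k' : 'I_n, s <= k < c -> k \in B ->
     nat_of_ord k' = (if nat_of_ord k == c.-1 then s else k.+1) -> k' \in B) ->
  forall k : 'I_n, s <= k < c -> k \in B.
Proof.
move=> cn ic iB step.
have up (k : 'I_n) : s <= k < c -> k \in B -> forall m (k' : 'I_n),
    k' < c -> nat_of_ord k' = k + m -> k' \in B.
  move=> kc kB; elim=> [|m IH] k' k'c k'E.
    by suff -> : k' = k by []; apply: val_inj; rewrite /= k'E addn0.
  have pk : k + m < n by apply: leq_trans (ltn_ord k'); rewrite k'E addnS.
  apply: (step (Ordinal pk)) => /=.
  - by move: kc k'c k'E; clear; lia.
  - by apply: IH => //=; move: k'c k'E; clear; lia.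
  - by move: k'c k'E; case: eqP; lia.
have cl : c.-1 < n by move: ic cn; clear; lia.
have sn : s < n by move: ic cn; clear; lia.
have lB : Ordinal cl \in B.
  by apply: (up i ic iB (c.-1 - i)) => /=; move: ic; clear; lia.
have sB : Ordinal sn \in B.
  by apply: (step (Ordinal cl)) => //=; [move: ic; clear; lia|rewrite eqxx].
move=> k kc; apply: (up (Ordinal sn) _ sB (k - s)) => /=; move: kc; clear; lia.
Qed.

Lemma no_large_wheel d r s : sorted leq d -> 0 < r -> r <= s -> 2 * s - r + 2 <= size d ->
  (forall i, i < r.-1 -> nth 0 d i <= i) ->
  (forall i, i < s.-1 -> nth 0 d i <= i.+1) ->
  (forall i, s.-1 <= i < 2 * s - r + 2 -> nth 0 d i = s.+1) ->
  (forall i, 2 * s - r + 2 <= i < size d -> nth 0 d i <= i) ->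
  exists e : rel 'I_(size d), outdeg_seq e = d /\ ~ has_two_disjoint_cycles e.
Proof.
move=> sd r0 rs cn hr hs hc ht; pose D := nth 0 d.
pose c := 2 * s - r + 2.
have yn : s.-1 < size d by lia.
pose y := Ordinal yn.
have sn : s < size d by lia.
pose nxt (i : nat) := if i == c.-1 then s else i.+1.
pose e : rel 'I_(size d) := fun i j =>
  if i == y then (j < r.-1) || (s <= j < c) else
  if s <= i < c then (j < s) || (nat_of_ord j == nxt i) else
  if D i <= i then j < D i else (j < i) || (j == y).
have nxtP i : s <= i < c -> s <= nxt i < c /\ nxt i <> i.
  by rewrite /nxt /c; case: eqP; lia.
exists e; split.
  apply: outdeg_seq_ord => // i; rewrite /outdeg -/(D i); have := ltn_ord i => ni.
  have [iy|iy] := eqVneq i y.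
    have -> : D i = s.+1 by apply: hc; rewrite iy /=; lia.
    have -> : [set j | e i j] =
        [set j : 'I_(size d) | 0 <= j < c] :\: [set j : 'I_(size d) | r.-1 <= j < s].
      apply/setP => j; rewrite !inE /e iy eqxx /=; move: rs r0; rewrite /c; lia.
    rewrite cardsD (setIidPr _); last by apply/subsetP => j; rewrite !inE /c; lia.
    by rewrite !card_ord_itv //; rewrite /c; lia.
  have iy' : nat_of_ord i <> s.-1 by move=> iE; case/eqP: iy; apply: val_inj.
  have [ic|ic] := boolP (s <= i < c).
    have -> : D i = s.+1 by apply: hc; move: ic; rewrite /c; lia.
    have [nc ni'] := nxtP _ ic.
    have nn : nxt i < size d by move: nc; rewrite /c; lia.
    have -> : [set j | e i j] = Ordinal nn |: [set j : 'I_(size d) | j < s].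
      by apply/setP => j; rewrite !inE /e (negbTE iy) ic orbC.
    rewrite cardsU1 inE /= card_ord_lt; last by lia.
    by have -> : (nxt i < s) = false by lia.
  have [di|di] := leqP (D i) i.
    rewrite -[RHS](@card_ord_lt (size d)); last by lia.
    by apply: eq_card => j; rewrite !inE /e (negbTE iy) (negbTE ic) di.
  have is_ : i < s.-1.
    rewrite ltnNge; apply/negP => si.
    have /ht : 2 * s - r + 2 <= i < size d by move: ic si iy'; rewrite /c; lia.
    by move: di; rewrite /D; lia.
  have -> : D i = i.+1 by move: (hs i is_) di; rewrite /D; lia.
  have -> : [set j | e i j] = y |: [set j : 'I_(size d) | j < i].
    by apply/setP => j; rewrite !inE /e (negbTE iy) (negbTE ic) leqNgt di /= orbC.
  rewrite cardsU1 inE /= card_ord_lt; last by lia.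
  by have -> : (s.-1 < i) = false by lia.
move=> /two_cyc_has [B1 [B2 [_ _ c1 c2 dB]]].
pose U := [set j : 'I_(size d) | s <= j < c].
have hub_or_rim B : cyc e B -> (y \in B /\ exists2 u, u \in U & u \in B) \/ U \subset B.
  move=> cB; have [i iB [mi [j jB eij]]] := cyc_min cB; have ij := mi j jB.
  have /cycP [_ hB] := cB.
  have yU : y \in B -> r.-1 <= i -> exists2 u, u \in U & u \in B.
    move=> yB ri; have [u uB] := hB y yB; rewrite /e eqxx => /orP[|uc].
      by rewrite ltnNge (leq_trans ri (mi u uB)).
    by exists u => //; rewrite inE.
  have [iy|iy] := eqVneq i y.
    by left; rewrite -{1}iy; split=> //; apply: yU; rewrite -?iy // iy /=; lia.
  have iy' : nat_of_ord i <> s.-1 by move=> iE; case/eqP: iy; apply: val_inj.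
  move: eij; rewrite /e (negbTE iy); have [ic _|ic] := boolP (s <= i < c); last first.
    have [di|di] := leqP (D i) i; first by rewrite ltnNge (leq_trans di ij).
    case/orP => [|/eqP jy]; first by rewrite ltnNge ij.
    rewrite jy in jB; left; split=> //; apply: yU => //; rewrite leqNgt; apply/negP => /hr.
    by rewrite leqNgt di.
  right; apply/subsetP => k; rewrite inE => kc.
  have cs : c <= size d by [].
  apply: (rim_closed cs ic iB) kc => {}k k' kc kB k'E; have [z zB] := hB k kB; rewrite /e.
  have -> : (k == y) = false.
    by apply/negP => /eqP ky; move: kc; rewrite ky /= leqNgt prednK ?leqnn // (leq_trans r0).
  rewrite kc => /orP[zs|/eqP zE].
    by rewrite ltnNge (leq_trans _ (mi z zB)) in zs; case/andP: ic.
  by suff -> : k' = z by []; apply: val_inj; rewrite /= k'E zE.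
have U0 : exists u, u \in U by exists (Ordinal sn); rewrite inE /= /c; lia.
case: (hub_or_rim _ c1) (hub_or_rim _ c2) =>
    [[y1 [u1 u1U u1B]]|/subsetP s1] [[y2 [u2 u2U u2B]]|/subsetP s2].
- by have := disjointFr dB y1; rewrite y2.
- by have := disjointFr dB u1B; rewrite s2.
- by have := disjointFr dB (s1 _ u2U); rewrite u2B.
- by have [u uU] := U0; have := disjointFr dB (s1 _ uU); rewrite s2.
Qed.

Lemma not_large_digraph d : 0 < size d -> sorted leq d ->
  large d \/ exists e : rel 'I_(size d), outdeg_seq e = d /\ ~ has_two_disjoint_cycles e.
Proof.
move=> d0 sd.
have mono a b : a <= b -> b < size d -> nth 0 d a <= nth 0 d b.
  by move=> ab bd; apply: (sorted_leq_nth leq_trans leqnn) => //; rewrite inE; lia.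
pose P s := (0 < s <= size d) && (s < entry d s).
have [/hasP [s0 _ Ps0]|/hasPn nP] := boolP (has P (iota 0 (size d).+1)); last first.
  right; apply: no_large_acyclic => // i id_; have := nP i.+1.
  by rewrite mem_iota /P /entry /= add0n ltnS id_ /= -leqNgt; exact.
have [s /andP[sn ds] smin] := ex_minnP (ex_intro P s0 Ps0).
pose Q r := (0 < r <= s) && (r <= entry d r).
have exQ : exists r, Q r by exists s; rewrite /Q; move: sn ds; lia.
have [r /andP[rs dr] rmin] := ex_minnP exQ.
have lg : (2 * s - r + 2 <= size d -> entry d (2 * s - r + 2) = s + 1 ->
       exists j, 2 * s - r + 3 <= j /\ j <= size d /\ j <= entry d j) -> large d.
  by move=> h; exists r, s; split; [split; lia|split; [lia|]].
have [h1|h1] := leqP (2 * s - r + 2) (size d); last by left; apply: lg; lia.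
have [h2|/eqP h2] := eqVneq (entry d (2 * s - r + 2)) (s + 1); last by left; apply: lg.
pose J j := (2 * s - r + 3 <= j) && (j <= entry d j).
have [/hasP [j jn /andP[j1 j2]]|/hasPn nJ] := boolP (has J (iota 0 (size d).+1)).
  by left; apply: lg => _ _; exists j; move: jn; rewrite mem_iota; lia.
right; apply: (@no_large_wheel d r s) => //; [lia|lia| | | |].
- move=> i ir; rewrite leqNgt; apply/negP => di.
  have : Q i.+1 by rewrite /Q /entry /=; lia.
  by move/rmin; lia.
- move=> i is_; rewrite leqNgt; apply/negP => di.
  have : P i.+1 by rewrite /P /entry /=; lia.
  by move/smin; lia.
- move=> i /andP[i1 i2]; move: ds h2; rewrite /entry => ds h2.
  have := mono _ _ i1; have := mono i (2 * s - r + 2).-1; lia.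
- move=> i /andP[i1 i2]; have := nJ i.+1; rewrite mem_iota /J /entry /=; lia.
Qed.

Theorem theorem1p4 (n : nat) (d : seq nat) (n_gt0 : 0 < n)
    (size_d : size d = n) (sorted_d : sorted leq d) :
  (forall (V : finType) (e : rel V),
     #|V| = n -> outdeg_seq e = d -> has_two_disjoint_cycles e)
  <-> large d.
Proof.
split=> [h|ld V e _ ed]; last first.
  by apply/two_cyc_has/large_on_two_cyc/large_large_on; rewrite ed.
have d0 : 0 < size d by rewrite size_d.
have [//|[e [ed nT]]] := not_large_digraph d0 sorted_d.
by case: nT; apply: h => //; rewrite card_ord.
Qed.
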